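(* Let $\Omega\subset\mathbb{R}$ be a bounded open set and let $f:\mathbb{R}\to\mathbb{R}$ be a continuous function such that $f(\xi)\ge\gamma(|\xi|)$ for all $\xi\in\mathbb{R}$, where $\gamma:\mathbb{R}^+\to\mathbb{R}^+$ is a continuous increasing function with $\lim_{t\to+\infty}\gamma(t)=+\infty$. Then, for every Lipschitz function $u_0:\partial\Omega\to\mathbb{R}$, the problem $$(P)\quad \inf\Big\{\operatorname*{ess\,sup}_{x\in\Omega}f(u'(x)):\ u\in u_0+W^{1,\infty}_0(\Omega)\Big\}$$ admits a solution.
   Context: $\mathbb{R}^+=[0,+\infty)$. $W^{1,\infty}_0(\Omega)$ is the closure of $C_0^\infty(\Omega)$ in $W^{1,1}(\Omega)$ intersected with $W^{1,\infty}(\Omega)$. When $u_0$ is given only on $\partial\Omega$ as a Lipschitz function, it is extended to $\Omega$ as a Lipschitz function (still denoted $u_0$), and $u_0+W^{1,\infty}_0(\Omega)$ is understood with respect to this extension. A solution is an admissible $u$ at which the infimum is attained. *)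

(* Defs.v *)
From HB Require Import structures.
From mathcomp Require Import all_boot all_order all_algebra.
From mathcomp Require Import all_classical all_reals all_analysis.
From mathcomp Require Import ess_sup_inf.

Set Implicit Arguments.
Unset Strict Implicit.
Unset Printing Implicit Defensive.

Import Order.TTheory GRing.Theory Num.Theory.
Import numFieldNormedType.Exports.

Local Open Scope classical_set_scope.
Local Open Scope ring_scope.

(* Functions on an open set Omega of the line are represented by total
   functions R -> R whose values outside Omega are irrelevant; functions
   defined a.e. on Omega are represented by any (Borel) representative. *)

Section definitions.
Context {R : realType}.
Implicit Types (A Omega : set R) (f g u v phi : R -> R).

Local Notation mu := (@lebesgue_measure R).

Definition boundary A : set R := closure A `\` interior A.

(* The value -oo outside A is neutral for the supremum, see [ess_sup_onP]. *)
Definition ess_sup_on A (g : R -> \bar R) : \bar R :=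
  ess_sup mu (patch (cst -oo%E) A g).

Definition closed_support phi : set R := closure [set x | phi x != 0].

(* C_0^oo(Omega) *)
Definition test_function Omega phi : Prop :=
  [/\ forall (n : nat) (x : R), derivable (phi^`(n))%classic x 1,
      compact (closed_support phi) & closed_support phi `<=` Omega].

Definition is_weak_derivative Omega u v : Prop :=
  [/\ locally_integrable Omega u, locally_integrable Omega v &
      forall phi, test_function Omega phi ->
        \int[mu]_(x in Omega) (u x * (phi^`())%classic x) =
        - \int[mu]_(x in Omega) (v x * phi x)].

Definition weakly_derivable Omega u : Prop :=
  exists v, is_weak_derivative Omega u v.

(* Weak derivatives are unique up to a.e. equality on Omega; this picks one
   representative, and is only used for weakly derivable functions. *)
Definition weak_derivative Omega u : R -> R :=
  xget (cst 0) [set v | is_weak_derivative Omega u v].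

Definition L1 Omega g : Prop := mu.-integrable Omega (EFin \o g).

Definition Loo Omega g : Prop :=
  measurable_fun Omega g /\ (ess_sup_on Omega (fun x => `|g x|%:E) < +oo)%E.

Definition W11 Omega u : Prop :=
  [/\ weakly_derivable Omega u, L1 Omega u & L1 Omega (weak_derivative Omega u)].

Definition W1oo Omega u : Prop :=
  [/\ weakly_derivable Omega u, Loo Omega u &
      Loo Omega (weak_derivative Omega u)].

Definition W11_norm Omega u : \bar R :=
  (\int[mu]_(x in Omega) `|u x|%:E +
   \int[mu]_(x in Omega) `|weak_derivative Omega u x|%:E)%E.

Definition W11_closure_test Omega u : Prop :=
  W11 Omega u /\
  forall e : R, 0 < e ->
    exists2 phi, test_function Omega phi & (W11_norm Omega (u \- phi)%R < e%:E)%E.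

Definition W1oo0 Omega u : Prop := W11_closure_test Omega u /\ W1oo Omega u.

(* u0 + W^{1,oo}_0(Omega) *)
Definition admissible Omega u0 : set (R -> R) :=
  [set u | W1oo0 Omega (u \- u0)].

Definition sup_energy Omega f u : \bar R :=
  ess_sup_on Omega (fun x => (f (weak_derivative Omega u x))%:E).

Definition is_solution Omega f u0 u : Prop :=
  admissible Omega u0 u /\
  sup_energy Omega f u = ereal_inf (sup_energy Omega f @` admissible Omega u0).

Definition lipschitz_extension Omega u0 U : Prop :=
  [lipschitz U x | x in closure Omega] /\ {in boundary Omega, U =1 u0}.

Lemma ess_sup_onP A (g : R -> \bar R) (y : \bar R) :
  (ess_sup_on A g <= y)%E <-> {ae mu, forall x, A x -> (g x <= y)%E}.
Proof.
have aeF := ae_filter_ringOfSetsType mu.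
split=> [/ess_supP|gy].
  apply: (@filterS _ _ aeF) => x; rewrite /patch => + Ax.
  by rewrite mem_set.
apply/ess_supP; apply: (@filterS _ _ aeF _ _ _ gy) => x {}gy; rewrite /patch.
by case: ifPn => [/set_mem|_]; [exact: gy | rewrite leNye].
Qed.

End definitions.

(* Main.v *)
Require Import Defs.
From HB Require Import structures.
From mathcomp Require Import all_boot all_order all_algebra.
From mathcomp Require Import all_classical all_reals all_analysis.
From mathcomp Require Import ess_sup_inf measurable_realfun.
From mathcomp Require Import ring lra.

(** The energy sees a competitor only through its slopes. On a component
    [`]l, r[] of [Omega] every admissible [u] takes the values of [U] at both
    ends, so the mean of its derivative is the slope of the chord of [U]
    ([admissible_integral]). Let [m] be the infimum of the energy. If [f] exceeds
    some [t > m] on [`]-oo, x[], then a competitor of energy below [t] has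
    derivative at least [x] a.e., and [x] is at most the slope of every chord.
    Coercivity provides such points [x]; their supremum [p] is still at most
    every chord slope, and [f p <= m] by continuity ([sublevel_edge]). By
    symmetry some [q] with [f q <= m] is at least every chord slope. On each
    component there is thus a concave broken line with the boundary values of
    [U] and with slopes [q] and [p] only; these tents fit together to a
    Lipschitz function that equals [U] off [Omega], hence to a competitor of
    energy at most [m] ([exists_minimizer]).

    This uses the following facts on Lipschitz functions of one variable.

    A Lipschitz function is an indefinite integral of its a.e. derivative
    ([lipschitz_FTC]): after adding a multiple of the identity it is the
    distribution function of an absolutely continuous measure, to which the
    Radon-Nikodym and Lebesgue differentiation theorems apply. Hence a.e.
    derivatives of Lipschitz functions may be integrated by parts and are weak
    derivatives ([lipschitz_weak_derivative]). Weak derivatives are unique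
    ([weak_derivative_unique]) because smooth bumps tend to the indicator
    functions of intervals.

    A Lipschitz function that vanishes off the bounded open set [Omega] belongs
    to [W^{1,oo}_0(Omega)] ([lipschitz_W1oo0]): it is truncated near the boundary
    to a function of compact support whose Lipschitz constant is at most twice
    as large, then mollified. The derivatives stay bounded and converge at
    Lebesgue points, hence in mean, and Poincare's inequality takes care of the
    functions themselves.

    Finally, data given as a Lipschitz function on the closure of [Omega] are
    replaced by a globally Lipschitz [U] with the same values on [Omega], which
    changes neither the competitors nor their energies. *)

Set Implicit Arguments.
Unset Strict Implicit.
Unset Printing Implicit Defensive.

Import Order.TTheory GRing.Theory Num.Theory.
Import numFieldNormedType.Exports.

Local Open Scope classical_set_scope.
Local Open Scope ring_scope.

(** * The density of a Lipschitz function *)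

Section radon_nikodym_density.
Context {R : realType}.
Notation mu := (@lebesgue_measure R).
Variables (a b C : R) (W : R -> R).
Hypothesis ab : a < b.
Hypothesis C0 : 0 <= C.
Hypothesis Wlip : forall x y, a <= x -> x <= y -> y <= b -> `|W y - W x| <= C * (y - x).

(** [F] turns [W] into the distribution function of a measure: the slope [C]
    makes it nondecreasing, and freezing it outside [[a, b]] makes the measure
    finite. *)
Let cl (x : R) : R := Num.max a (Num.min x b).
Let F (x : R) : R := W (cl x) + C * cl x.

Let clE z : [\/ z <= a /\ cl z = a, a <= z <= b /\ cl z = z | b <= z /\ cl z = b].
Proof.
rewrite /cl; have [zb|/ltW bz] := leP z b; last by apply: Or33; rewrite max_r// ltW.
by have [az|/ltW za] := leP a z; [apply: Or32|apply: Or31].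
Qed.

Let cl_mon x y : x <= y -> [/\ a <= cl x, cl x <= cl y, cl y <= b & cl y - cl x <= y - x].
Proof.
move=> xy; have ab' := ab.
by case: (clE x) => -[hx ->]; case: (clE y) => -[hy ->]; split; lra.
Qed.

Let F_incr x y : x <= y -> 0 <= F y - F x <= 2 * C * (y - x).
Proof.
move=> xy; have [h1 h2 h3 h4] := cl_mon xy.
have := Wlip h1 h2 h3; rewrite ler_norml /F => /andP[w1 w2].
have : C * (cl y - cl x) <= C * (y - x) by exact: ler_wpM2l.
by have := C0 => ? ?; apply/andP; split; lra.
Qed.

Let F_nd : nondecreasing F.
Proof. by move=> x y xy; have /andP[] := F_incr xy; rewrite subr_ge0. Qed.

Let F_rc : right_continuous F.
Proof.
apply: right_continuousW => x; apply/cvgrPdist_le => e e0.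
have C1 : 0 < 2 * C + 1 by have := C0; lra.
near=> y.
have xy : `|x - y| <= e / (2 * C + 1).
  by near: y; apply: cvgr_dist_le; [exact: cvg_id|rewrite divr_gt0].
have ee : (2 * C + 1) * `|x - y| <= e by rewrite mulrC -ler_pdivlMr.
have [xley|/ltW ylex] := leP x y.
  have /andP[h1 h2] := F_incr xley; rewrite distrC ger0_norm//.
  by move: ee; rewrite distrC ger0_norm ?subr_ge0//; lra.
have /andP[h1 h2] := F_incr ylex; rewrite ger0_norm//.
by move: ee; rewrite ger0_norm ?subr_ge0//; lra.
Unshelve. all: by end_near. Qed.

HB.instance Definition _ := isCumulative.Build R _ R F F_nd F_rc.

Let nu := lebesgue_stieltjes_measure F.

Let nu_itv x y : x <= y -> nu `]x, y]%classic = (F y - F x)%:E.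
Proof.
move=> xy; rewrite /nu /lebesgue_stieltjes_measure /measure_extension.
rewrite measurable_mu_extE/=; last exact: is_ocitv.
by rewrite wlength_itv_bnd.
Qed.

(** Absolute continuity is read off the covers by half-open intervals that
    define both outer measures: passing from lengths to increments of [F] costs
    at most the factor [2 * C]. *)
Let nu_dom : nu `<< mu.
Proof.
apply/null_content_dominatesP => A mA A0.
apply/eqP; rewrite eq_le measure_ge0 andbT; apply/lee_addgt0Pr => e e0; rewrite add0e.
have C1 : 0 < 2 * C + 1 by have := C0; lra.
have e1 : 0 < e / (2 * C + 1) by rewrite divr_gt0.
have : (mu A < (e / (2 * C + 1))%:E)%E by rewrite A0 lte_fin.
rewrite {1}/lebesgue_measure /lebesgue_stieltjes_measure /measure_extension /mu_ext.
case/ereal_inf_lt => _ [B [mB AB] <-] /ltW sB.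
rewrite /nu /lebesgue_stieltjes_measure /measure_extension /mu_ext.
apply: ereal_inf_le; eexists; first by exists B.
have -> : e = (2 * C + 1) * (e / (2 * C + 1)) by rewrite mulrC divfK ?gt_eqF.
apply: (@le_trans _ _ ((2 * C + 1)%:E * \sum_(k <oo) wlength idfun (B k))%E); last first.
  by rewrite EFinM; apply: lee_wpmul2l => //; rewrite lee_fin ltW.
rewrite -nneseriesZl//.
apply: lee_nneseries => [k _ _|k _]; first exact: wlength_ge0.
have /ocitvP[->|[[x y] /= xy ->]] := mB k.
  by rewrite [leLHS]wlength0 [X in (_ * X)%E]wlength0 mule0.
rewrite !wlength_itv_bnd ?(ltW xy)//= lee_fin.
have /andP[_ h] := F_incr (ltW xy); apply: (le_trans h).
by apply: ler_wpM2r; lra.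
Qed.

Let nu_fin : fin_num_fun nu.
Proof.
apply: lty_fin_num_fun.
rewrite -(@bigcup_itvT R false false).
have mI n : measurable (`](- n%:R), n%:R]%classic : set R) by exact: measurable_itv.
have : nu `](- n%:R), n%:R]%classic @[n --> \oo] --> nu (\bigcup_n `](- n%:R), n%:R]%classic).
  apply: nondecreasing_cvg_mu => //; first exact: bigcup_measurable.
  move=> n m nm; apply/subsetPset => x /=; rewrite !in_itv/= => /andP[h1 h2].
  have : n%:R <= m%:R :> R by rewrite ler_nat.
  by move=> ?; apply/andP; split; lra.
move=> h; apply: (@le_lt_trans _ _ (2 * C * (b - a))%:E); last exact: ltry.
apply: (cvge_to_le h); apply: nearW => n.
rewrite nu_itv; last by rewrite -subr_ge0 opprK addr_ge0.
have [h1 h2 h3 _] := @cl_mon (- n%:R) n%:R ltac:(by rewrite -subr_ge0 opprK addr_ge0).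
have := Wlip h1 h2 h3; rewrite ler_norml lee_fin /F => /andP[_ ?].
have : C * (cl n%:R - cl (- n%:R)) <= C * (b - a) by apply: ler_wpM2l => //; have := C0; lra.
by lra.
Qed.
HB.instance Definition _ := Measure.on nu.
HB.instance Definition _ := @Measure_isFinite.Build _ _ _ nu nu_fin.

(** The Radon-Nikodym density of [nu] integrates to the increments of [F];
    subtracting the slope [C] gives those of [W]. *)
Lemma lipschitz_RN_density : exists g : R -> R, [/\ measurable_fun setT g,
  mu.-integrable `[a, b] (EFin \o g) &
  forall x y, a <= x -> x <= y -> y <= b -> \int[mu]_(t in `[x, y]) g t = W y - W x].
Proof.
have [f [f0 ffin fint fE]] := radon_nikodym_sigma_finite nu_dom.
have fineK' x : (fine (f x))%:E = f x by rewrite fineK.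
have mf : measurable_fun setT (fine \o f).
  by apply: (measurableT_comp (fine_measurable (@measurableT _ _))) => //; exact: measurable_int fint.
have fint' : mu.-integrable setT (EFin \o (fine \o f)).
  by apply: eq_integrable fint => // x _; rewrite /= fineK'.
have intC (x y : R) : mu.-integrable `[x, y] (EFin \o cst C).
  apply: continuous_compact_integrable; first exact: segment_compact.
  by apply: continuous_subspaceT => z; exact: cvg_cst.
exists (fun x => fine (f x) - C); split.
- exact: measurable_funB.
- apply: (@eq_integrable _ _ _ _ _ _ ((EFin \o (fine \o f)) \- (EFin \o cst C))%E) => //.
  by apply: integrableB => //; by apply: integrableS fint'.
move=> x y ax xy yb; rewrite RintegralB//; last by apply: integrableS fint'.
rewrite Rintegral_cst//= -Rintegral_itv_obnd_cbnd; last by apply: integrableS fint'.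
rewrite /Rintegral; under eq_integral do rewrite fineK'.
have -> : (\int[mu]_(t in `]x, y]) f t = nu `]x, y]%classic)%E by rewrite fE.
rewrite nu_itv//= lebesgue_measure_itv/= lte_fin /F.
have clid z : a <= z -> z <= b -> cl z = z.
  by move=> az zb; rewrite /cl min_l// max_r.
rewrite !clid//; [|lra|lra].
case: ltP => h /=; first by ring.
by have -> : x = y; lra.
Qed.

End radon_nikodym_density.

(** Almost every point is a Lebesgue point of [g], and the primitive of [g] is
    differentiable there. *)
Lemma ae_is_derive_primitive {R : realType} (a b : R) (W g : R -> R) : a < b ->
  lebesgue_measure.-integrable `[a, b] (EFin \o g) ->
  (forall x, a <= x <= b -> \int[lebesgue_measure]_(t in `[a, x]) g t = W x - W a) ->
  {ae lebesgue_measure, forall x, a < x < b -> is_derive x 1 W (g x)}.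
Proof.
move=> ab ig Wg.
have := lebesgue_differentiation (integrable_locally_restrict (measurable_itv _) ig).
have aeF := ae_filter_ringOfSetsType (@lebesgue_measure R).
apply: (@filterS _ _ aeF) => x /[swap] /andP[ax xb] gx.
have ig' : lebesgue_measure.-integrable `[a, b] (EFin \o (g \_ `[a, b])).
  by apply: eq_integrable ig => // z zab; rewrite /= patchE zab.
have [dF F'] := FTC1_lebesgue_pt xb ig' ax gx.
set F := fun y : R => _ in dF F'.
have gE : (g \_ `[a, b]) x = g x.
  by rewrite patchE ifT// inE/= in_itv/= (ltW ax) (ltW xb).
have WF : {near x, F + cst (W a) =1 W}.
  near=> y.
  have /andP[ay yb] : a <= y <= b.
    by apply/andP; split; apply/ltW; near: y; [exact: lt_nbhsr|exact: lt_nbhsl].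
  rewrite /F /= fctE -[RHS](subrK (W a)) -Wg ?ay//; congr (_ + _).
  apply: eq_Rintegral => t; rewrite inE/= => /itvP tay.
  by rewrite patchE ifT// inE/= in_itv/= tay/= (le_trans _ yb)// tay.
have dFx : is_derive x 1 F (g x) by apply: DeriveDef => //; rewrite -derive1E F'.
have := is_derive_eq (is_deriveD dFx (is_derive_cst (W a) x 1)) (addr0 _).
exact: near_eq_is_derive WF.
Unshelve. all: by end_near. Qed.

(** * Lipschitz functions on an interval *)

Section lipschitz_itv.
Context {R : realType}.
Notation mu := (@lebesgue_measure R).
Implicit Types (a b C x y : R) (W g : R -> R).

Definition lipschitz_itv C a b W :=
  forall x y, a <= x -> x <= y -> y <= b -> `|W y - W x| <= C * (y - x).

Lemma lipschitz_itv_ge0 C a b W : a < b -> lipschitz_itv C a b W -> 0 <= C.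
Proof.
move=> ab /(_ a b (lexx _) (ltW ab) (lexx _)) /(le_trans (normr_ge0 _)).
by rewrite pmulr_lge0// subr_gt0.
Qed.

Lemma lipschitz_itv_bounded C a b W : a < b -> lipschitz_itv C a b W ->
  forall x, x \in `[a, b] -> `|W x| <= `|W a| + C * (b - a).
Proof.
move=> ab l x; rewrite in_itv/= => /andP[ax xb].
have C0 := lipschitz_itv_ge0 ab l.
have := l a x (lexx _) ax xb => h.
have : C * (x - a) <= C * (b - a) by apply: ler_wpM2l => //; lra.
have : `|W x| <= `|W x - W a| + `|W a| by rewrite -{1}(subrK (W a) (W x)) ler_normD.
by lra.
Qed.

Lemma lipschitz_itv_continuous C a b W : a < b -> lipschitz_itv C a b W ->
  {within `[a, b], continuous W}.
Proof.
move=> ab l; apply/subspace_continuousP => x /=; rewrite in_itv/= => /andP[ax xb].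
have C0 := lipschitz_itv_ge0 ab l.
apply/cvgrPdist_le => e e0.
have C1 : 0 < C + 1 by lra.
have nxy : \forall y \near x, `|x - y| <= e / (C + 1).
  have /cvgrPdist_le := @cvg_id _ (nbhs x); apply.
  by rewrite divr_gt0.
near=> y.
have : y \in `[a, b] by near: y; exact: withinT.
rewrite in_itv/= => /andP[ay yb].
have xy : `|x - y| <= e / (C + 1).
  by near: y; exact: cvg_within nxy.
have ee : (C + 1) * `|x - y| <= e by rewrite mulrC -ler_pdivlMr.
have [xley|/ltW ylex] := leP x y.
  rewrite distrC (le_trans (l _ _ ax xley yb))// (le_trans _ ee)//.
  by rewrite distrC ger0_norm ?subr_ge0//; apply: ler_wpM2r => //; lra.
rewrite (le_trans (l _ _ ay ylex xb))// (le_trans _ ee)//.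
by rewrite ger0_norm ?subr_ge0//; apply: ler_wpM2r => //; lra.
Unshelve. all: by end_near. Qed.

Lemma lipschitz_itv_measurable C a b W : a < b -> lipschitz_itv C a b W ->
  measurable_fun `[a, b] W.
Proof.
move=> ab /(lipschitz_itv_continuous ab).
exact: subspace_continuous_measurable_fun.
Qed.

Lemma lipschitz_itvM C D a b W V : a < b ->
  lipschitz_itv C a b W -> lipschitz_itv D a b V ->
  exists E, lipschitz_itv E a b (W \* V).
Proof.
move=> ab lW lV; have C0 := lipschitz_itv_ge0 ab lW; have D0 := lipschitz_itv_ge0 ab lV.
exists ((`|W a| + C * (b - a)) * D + (`|V a| + D * (b - a)) * C) => x y ax xy yb /=.
have -> : W y * V y - W x * V x = W y * (V y - V x) + V x * (W y - W x) by ring.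
rewrite (le_trans (ler_normD _ _))// !normrM mulrDl -!mulrA; apply: lerD.
- apply: ler_pM => //; last exact: lV.
  by apply: (lipschitz_itv_bounded ab lW); rewrite in_itv/= yb (le_trans ax).
- apply: ler_pM => //; last exact: lW.
  by apply: (lipschitz_itv_bounded ab lV); rewrite in_itv/= ax (le_trans xy).
Qed.

Lemma is_derive_unique W x (d e : R) : is_derive x 1 W d -> is_derive x 1 W e -> d = e.
Proof. by move=> [_ <-] [_ <-]. Qed.

Lemma is_derive_lipschitz C a b W x d : lipschitz_itv C a b W -> a < x < b ->
  is_derive x 1 W d -> `|d| <= C.
Proof.
move=> l /andP[ax xb] [dW <-].
have ab := lt_trans ax xb; have C0 := lipschitz_itv_ge0 ab l.
have : h^-1 *: (W (h *: 1 + x) - W x) @[h --> 0^'] --> 'D_1 W x by exact: dW.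
move/cvg_norm/(cvgr_to_le); apply.
near=> h.
have h0 : h != 0 by near: h; exact: nbhs_dnbhs_neq.
rewrite scaler1 normrZ normfV mulrC ler_pdivrMr ?normr_gt0//.
have [ahx hxb] : a <= h + x /\ h + x <= b.
  have : `|h| < Num.min (x - a) (b - x).
    by near: h; apply: dnbhs0_lt; rewrite lt_min !subr_gt0 ax.
  by rewrite lt_min !ltr_norml => /andP[/andP[? ?] /andP[? ?]]; split; lra.
have [hp|hn] := leP 0 h.
  rewrite (ger0_norm hp); have -> : C * h = C * (h + x - x) by rewrite addrK.
  by apply: l; lra.
rewrite distrC (ltr0_norm hn) (_ : - h = x - (h + x)); last by ring.
by apply: l; lra.
Unshelve. all: by end_near. Qed.

Lemma bounded_integrable (A : set R) (f : R -> R) M : measurable A -> (mu A < +oo)%E ->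
  measurable_fun A f -> (forall x, A x -> `|f x| <= M) -> mu.-integrable A (EFin \o f).
Proof.
move=> mA Aoo mf fM; apply: measurable_bounded_integrable => //.
exists M; split; first by rewrite num_real.
by move=> N MN x Ax; rewrite /= (le_trans (fM _ Ax))// ltW.
Qed.

Lemma itv_measure_lty a b : (mu `[a, b] < +oo)%E.
Proof. by rewrite lebesgue_measure_itv/= lte_fin; case: ifP => _; rewrite ltry. Qed.

(** Truncating the density at [C] makes the bound hold everywhere, and it leaves
    the density alone wherever it is the derivative of [W]. *)
Lemma lipschitz_density C a b W : a < b -> lipschitz_itv C a b W ->
  exists g, [/\ measurable_fun setT g, forall x, `|g x| <= C &
    {ae mu, forall x, a < x < b -> is_derive x 1 W (g x)}].
Proof.
move=> ab l; have C0 := lipschitz_itv_ge0 ab l.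
have [g [mg ig gE]] := lipschitz_RN_density ab C0 l.
exists (fun x => Num.max (- C) (Num.min (g x) C)); split.
- by apply: measurable_maxr => //; apply: measurable_minr.
- by move=> x; rewrite ler_norml le_max lexx/= ge_max ge_min lexx orbT andbT; lra.
have aeF := ae_filter_ringOfSetsType mu.
have := @ae_is_derive_primitive R a b W g ab ig.
move=> /(_ (fun x xab => gE a x (lexx _) (andP xab).1 (andP xab).2)).
apply: (@filterS _ _ aeF) => x /= h xab.
have dW := h xab; have := is_derive_lipschitz l xab dW.
by rewrite ler_norml => /andP[g1 g2]; rewrite min_l// max_r.
Qed.

Lemma ae_neq a : {ae mu, forall x, x <> a}.
Proof.
exists [set a]; split; [exact: measurable_set1|exact: lebesgue_measure_set1|].
by move=> x /= /contrapT.
Qed.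

Lemma ae_itvoocc a b (P : R -> Prop) : {ae mu, forall x, a < x < b -> P x} ->
  {ae mu, forall x, a <= x <= b -> P x}.
Proof.
have aeF := ae_filter_ringOfSetsType mu => dP.
apply: (@filterS3 _ _ aeF _ _ _ _ _ (ae_neq a) (ae_neq b) dP).
move=> x /eqP xa /eqP xb h /andP[ax bx]; apply: h.
by rewrite !lt_neqAle ax bx !andbT eq_sym xa.
Qed.

(** Any a.e. derivative [g] of [W] agrees a.e. with the Radon-Nikodym density of
    [W], so it inherits integrability and the increments of [W]. *)
Lemma lipschitz_FTC C a b W g : a < b -> lipschitz_itv C a b W ->
  measurable_fun `[a, b] g ->
  {ae mu, forall x, a < x < b -> is_derive x 1 W (g x)} ->
  mu.-integrable `[a, b] (EFin \o g) /\
  forall x y, a <= x -> x <= y -> y <= b -> \int[mu]_(t in `[x, y]) g t = W y - W x.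
Proof.
move=> ab l mg dg; have C0 := lipschitz_itv_ge0 ab l.
have [h [mh ih hE]] := lipschitz_RN_density ab C0 l.
have aeF := ae_filter_ringOfSetsType mu.
have dh : {ae mu, forall x, a < x < b -> is_derive x 1 W (h x)}.
  by apply: ae_is_derive_primitive => // x /andP[ax xb]; exact: hE.
have hg : {ae mu, forall x, a <= x <= b -> h x = g x}.
  apply: ae_itvoocc; apply: (@filterS2 _ _ aeF _ _ _ _ dg dh) => x gx hx xab.
  exact: is_derive_unique (hx xab) (gx xab).
have mE f x y : a <= x -> y <= b -> measurable_fun `[a, b] f ->
    measurable_fun `[x, y] (EFin \o f).
  move=> ax yb mf; apply/measurable_EFinP; apply: measurable_funS mf => //.
  by move=> z /=; rewrite !in_itv/= => /andP[xz zy]; rewrite (le_trans ax)// (le_trans zy).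
have mhab : measurable_fun `[a, b] h by exact: measurable_funS mh.
split.
  apply/integrableP; split; first exact: mE.
  have /integrableP[_] := ih; apply: le_lt_trans.
  rewrite le_eqVlt; apply/orP; left; apply/eqP.
  apply: ae_eq_integral => //; [by apply: measurableT_comp => //; exact: mE..|].
  by apply: (@filterS _ _ aeF _ _ _ hg) => x E; rewrite /= in_itv/= => /E ->.
move=> x y ax xy yb; rewrite -hE//; congr fine.
apply: ae_eq_integral => //; [exact: mE|exact: mE|].
apply: (@filterS _ _ aeF _ _ _ hg) => z E; rewrite /= in_itv/= => /andP[xz zy].
by rewrite E// (le_trans ax xz) (le_trans zy yb).
Qed.

(** The product of two Lipschitz functions is Lipschitz, so its increment is the
    integral of its a.e. derivative, which Leibniz' rule computes. *)
Lemma lipschitz_ibp C D a b W V g h : a < b ->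
  lipschitz_itv C a b W -> lipschitz_itv D a b V ->
  measurable_fun `[a, b] g -> measurable_fun `[a, b] h ->
  {ae mu, forall x, a < x < b -> is_derive x 1 W (g x)} ->
  {ae mu, forall x, a < x < b -> is_derive x 1 V (h x)} ->
  V a = 0 -> V b = 0 ->
  \int[mu]_(x in `[a, b]) (W x * h x) = - \int[mu]_(x in `[a, b]) (g x * V x).
Proof.
move=> ab lW lV mg mh dW dV Va Vb.
have aeF := ae_filter_ringOfSetsType mu.
have [ig _] := lipschitz_FTC ab lW mg dW.
have [ih _] := lipschitz_FTC ab lV mh dV.
have bd K U : lipschitz_itv K a b U -> [bounded U x | x in `[a, b]].
  move=> lU; exists (`|U a| + K * (b - a)); split; first by rewrite num_real.
  by move=> N UN x /(lipschitz_itv_bounded ab lU)/le_trans; apply; exact: ltW.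
have iWh : mu.-integrable `[a, b] (EFin \o (W \* h)).
  have -> : EFin \o (W \* h) = ((EFin \o W) \* (EFin \o h))%E by apply/funext.
  by apply: integrableMr => //; [exact: lipschitz_itv_measurable lW|exact: bd lW].
have igV : mu.-integrable `[a, b] (EFin \o (g \* V)).
  have -> : EFin \o (g \* V) = ((EFin \o g) \* (EFin \o V))%E by apply/funext.
  by apply: integrableMl => //; [exact: lipschitz_itv_measurable lV|exact: bd lV].
have [K lK] := lipschitz_itvM ab lW lV.
have mK : measurable_fun `[a, b] (W \* h \+ g \* V).
  by apply: measurable_funD; apply/measurable_EFinP;
    [case/integrableP: iWh|case/integrableP: igV].
have dK : {ae mu, forall x, a < x < b -> is_derive x 1 (W \* V) ((W \* h \+ g \* V) x)}.
  apply: (@filterS2 _ _ aeF _ _ _ _ dW dV) => x gx hx xab.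
  have dWx := gx xab; have dVx := hx xab.
  apply: is_derive_eq (is_deriveM dWx dVx) _.
  by rewrite /= [g x * _]mulrC.
have [_ /(_ a b (lexx _) (ltW ab) (lexx _))] := lipschitz_FTC ab lK mK dK.
rewrite /= Va Vb !mulr0 subr0 => E.
by apply/eqP; rewrite -addr_eq0 -RintegralD// E.
Qed.

End lipschitz_itv.

(** * Smooth bumps *)

Section smooth.
Context {R : realType}.
Implicit Types (f g : R -> R) (a b c d s x : R).

Fixpoint smoothn (n : nat) f : Prop :=
  if n is m.+1 then (forall x, derivable f x 1) /\ smoothn m (f^`())%classic else True.

Lemma smoothn_derivable f : (forall n, smoothn n f) ->
  forall n x, derivable (f^`(n))%classic x 1.
Proof.
move=> sf n; elim: n f sf => [|n ih] f sf x; first exact: (sf 1%N).1.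
by rewrite derive1Sn; apply: ih => m; exact: (sf m.+1).2.
Qed.

Lemma smoothnS n f g : (forall x, is_derive x 1 f (g x)) -> smoothn n g ->
  smoothn n.+1 f.
Proof.
move=> fg sg; split=> [x|]; first by case: (fg x).
suff -> : (f^`())%classic = g by [].
by apply/funext => x; rewrite derive1E; case: (fg x).
Qed.

Lemma smoothn_is_derive n f : smoothn n.+1 f ->
  forall x, is_derive x 1 f ((f^`())%classic x).
Proof. by move=> [df _] x; rewrite derive1E; exact/derivableP. Qed.

Lemma smoothnW n f : smoothn n.+1 f -> smoothn n f.
Proof. by elim: n f => // n ih f [df sf]; split=> //; exact: ih. Qed.

Lemma smoothnD n f g : smoothn n f -> smoothn n g -> smoothn n (f \+ g).
Proof.
elim: n f g => // n ih f g sf sg.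
apply: (@smoothnS _ _ ((f^`()) \+ (g^`()))%classic); last by apply: ih; [case: sf|case: sg].
move=> x; have fx := smoothn_is_derive sf x; have gx := smoothn_is_derive sg x.
exact: is_deriveD.
Qed.

Lemma smoothnM n f g : smoothn n f -> smoothn n g -> smoothn n (f \* g).
Proof.
elim: n f g => // n ih f g sf sg.
apply: (@smoothnS _ _ ((f \* g^`()) \+ (g \* f^`()))%classic); last first.
  by apply: smoothnD; apply: ih; [exact: smoothnW|case: sg|exact: smoothnW|case: sf].
move=> x; have fx := smoothn_is_derive sf x; have gx := smoothn_is_derive sg x.
exact: is_deriveM.
Qed.

Lemma smoothn_cst n c : smoothn n (cst c).
Proof.
elim: n c => // n ih c; apply: (@smoothnS _ _ (cst 0)) => // x.
Qed.

Lemma smoothn_affine n f s c : smoothn n f -> smoothn n (fun x => f (s * x + c)).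
Proof.
elim: n f => // n ih f sf.
apply: (@smoothnS _ _ (cst s \* (fun x => (f^`())%classic (s * x + c)))); last first.
  by apply: smoothnM; [exact: smoothn_cst|apply: ih; case: sf].
move=> x; have fx := smoothn_is_derive sf (s * x + c).
have l : is_derive x 1 (fun x => s * x + c) s.
  have := is_deriveD (is_deriveZ s (is_derive_id x 1)) (is_derive_cst c x 1).
  by move/is_derive_eq; apply; rewrite addr0; exact: mulr1.
move/is_derive_eq: (@is_derive1_comp _ _ (fun x => s * x + c) _ _ _ fx l); apply.
by rewrite /= mulrC.
Qed.

(** The derivatives of [exp(-1/x)] are combinations of [x^-k exp(-1/x)]; this
    family, extended by [0] to the left, is closed under differentiation (see
    [is_derive_flat]), so all its members are smooth. *)
Definition flat (k : nat) x : R := if 0 < x then x^-1 ^+ k * expR (- x^-1) else 0.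

Lemma flat_le0 k x : x <= 0 -> flat k x = 0.
Proof. by rewrite /flat leNgt => /negbTE ->. Qed.

Lemma flat_ge0 k x : 0 <= flat k x.
Proof.
rewrite /flat; case: ifPn => // x0.
by rewrite mulr_ge0 ?exprn_ge0 ?invr_ge0 ?ltW// expR_gt0.
Qed.

(** [exp t >= t^(k+1) / (k+1)!] at [t = 1/x]: each member of the family tends to
    [0] at the origin. *)
Lemma flat_bound k x : flat k x <= (k.+1)`!%:R * `|x|.
Proof.
rewrite /flat; case: ifPn => x0; last by rewrite mulr_ge0.
rewrite gtr0_norm// expRN -ler_pdivlMr ?invr_gt0 ?expR_gt0// invrK.
have t0 : 0 < x^-1 by rewrite invr_gt0.
have := expR_ge1Dxn k (ltW t0).
have f0 : 0 < (k.+1)`!%:R :> R by rewrite ltr0n fact_gt0.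
move=> h; have {}h : x^-1 ^+ k.+1 / (k.+1)`!%:R <= expR x^-1 by lra.
move: h; rewrite ler_pdivrMr// exprSr ler_pdivrMr//.
by rewrite -mulrA [expR _ * _]mulrC.
Qed.

Lemma is_derive_flat k x :
  is_derive x 1 (flat k) (flat k.+2 x - k%:R * flat k.+1 x).
Proof.
have [x0|x0|->] := ltrgtP x 0.
- rewrite !flat_le0 ?(ltW x0)// mulr0 subr0.
  apply: (@near_eq_is_derive _ R R (cst 0)).
  by near=> y; rewrite flat_le0// ltW//; near: y; exact: lt_nbhsl.
- apply: (@near_eq_is_derive _ R R ((fun y => y^-1) ^+ k * (expR \o (fun y => - y^-1)))).
    near=> y; have y0 : 0 < y by near: y; exact: lt_nbhsr.
    by rewrite /flat y0 mulrfctE exprfctE.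
  have iV : is_derive x 1 (fun y : R => y^-1) (- x ^- 2).
    have := is_deriveV (lt0r_neq0 x0) (is_derive_id x 1).
    by move/is_derive_eq; apply; exact: mulr1.
  have iE := @is_derive1_comp _ expR (fun y => - y^-1) _ _ _ (is_derive_expR _) (is_deriveN iV).
  move/is_derive_eq: (is_deriveM (is_deriveX k iV) iE); apply.
  rewrite /flat x0 exprfctE /= ?opprK.
  case: k {iE} => [|k] /=.
    by rewrite !mul0r subr0 !scale0r scaler0 addr0 expr0 scale1r mulrC exprVn.
  rewrite /GRing.scale/= !exprS !exprVn.
  by rewrite expr0; field; rewrite ?expf_neq0 ?lt0r_neq0.
(* At the origin the difference quotient of [flat k] is [flat k.+1]. *)
have f0 : flat k 0 = 0 by rewrite flat_le0.
have cf : flat k.+1 h @[h --> 0^'] --> (0 : R).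
  apply: (@squeeze_cvgr _ _ _ _ (cst 0) (fun h => (k.+2)`!%:R * `|h|)).
  - by apply: nearW => h; rewrite flat_ge0 flat_bound.
  - exact: cvg_cst.
  - rewrite -[X in _ --> X](mulr0 (k.+2)`!%:R); apply: cvgMr.
    have /cvg_norm : h @[h --> (0 : R)^'] --> (0 : R) by exact: cvg_within.
    by rewrite normr0.
have {}cf : h^-1 *: (flat k (h *: 1 + 0) - flat k 0) @[h --> 0^'] --> (0 : R).
  apply: cvg_trans cf; apply: near_eq_cvg; near=> h.
  have h0 : h != 0 by near: h; exact: nbhs_dnbhs_neq.
  rewrite f0 subr0 addr0 scaler1 /flat; case: ifP => hp; last by rewrite scaler0.
  by rewrite exprS -mulrA.
rewrite !flat_le0// mulr0 subr0.
by apply: DeriveDef; [apply/cvg_ex; exists 0|exact: cvg_lim].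
Unshelve. all: by end_near. Qed.

Lemma smoothn_flat n k : smoothn n (flat k).
Proof.
elim: n k => // n ih k; apply: smoothnS (is_derive_flat k) _.
have -> : (fun x => flat k.+2 x - k%:R * flat k.+1 x) = flat k.+2 \+ (cst (- k%:R) \* flat k.+1).
  by apply/funext => x /=; rewrite mulNr.
by apply: smoothnD => //; apply: smoothnM => //; exact: smoothn_cst.
Qed.

(** Supported in [[c, d]]; it tends to the indicator of [`]c, d[] as the
    steepness [s] grows. *)
Definition smooth_bump s c d x := flat 0 (s * (x - c)) * flat 0 (s * (d - x)).

Lemma smoothn_smooth_bump n s c d : smoothn n (smooth_bump s c d).
Proof.
have -> : smooth_bump s c d =
    (fun x => flat 0 (s * x + (- (s * c)))) \* (fun x => flat 0 (- s * x + (s * d))).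
  apply/funext => x.
  by rewrite /smooth_bump /= !mulrBr mulNr addrC [in X in _ * flat 0 X]addrC.
by apply: smoothnM; apply: smoothn_affine; exact: smoothn_flat.
Qed.

Lemma smooth_bump_ge0 s c d x : 0 <= smooth_bump s c d x.
Proof. by rewrite mulr_ge0// flat_ge0. Qed.

Lemma flat0_le1 x : flat 0 x <= 1.
Proof.
rewrite /flat; case: ifPn => // x0.
by rewrite expr0 mul1r expR_le1 oppr_le0 invr_ge0 ltW.
Qed.

Lemma smooth_bump_le1 s c d x : smooth_bump s c d x <= 1.
Proof. by rewrite -[1]mulr1; apply: ler_pM; rewrite ?flat_ge0 ?flat0_le1. Qed.

Lemma smooth_bump_out s c d x : 0 < s -> ~~ (c < x < d) -> smooth_bump s c d x = 0.
Proof.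
move=> s0; rewrite negb_and -!leNgt => /orP[xc|dx]; rewrite /smooth_bump.
  by rewrite flat_le0 ?mul0r// pmulr_rle0// subr_le0.
by rewrite [X in _ * X]flat_le0 ?mulr0// pmulr_rle0// subr_le0.
Qed.

Lemma smooth_bump_cvg c d x : c < x < d -> smooth_bump n.+1%:R c d x @[n --> \oo] --> (1 : R).
Proof.
move=> /andP[cx xd].
have h a : 0 < a -> flat 0 (n.+1%:R * a) @[n --> \oo] --> (1 : R).
  move=> a0; rewrite -[X in _ --> X]expR0.
  have -> : (fun n => flat 0 (n.+1%:R * a)) = (fun n => expR (- (a^-1 * harmonic n))).
    apply/funext => n; rewrite /flat mulr_gt0// expr0 mul1r /harmonic /=.
    by rewrite invfM mulrC.
  apply: continuous_cvg; first exact: continuous_expR.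
  rewrite -oppr0 -(mulr0 a^-1); apply: cvgN; apply: cvgMr.
  exact: cvg_harmonic.
by rewrite -[X in _ --> X]mulr1; apply: cvgM; apply: h; rewrite subr_gt0.
Qed.

End smooth.

(** * Test functions and weak derivatives *)

Section weak_derivatives.
Context {R : realType}.
Notation mu := (@lebesgue_measure R).
Implicit Types (Omega : set R) (f g u v phi psi : R -> R) (a b c d x : R).

Lemma derivable_continuous f : (forall x, derivable f x 1) -> continuous f.
Proof.
by move=> df x; apply: differentiable_continuous; apply/derivable1_diffP.
Qed.

Lemma C1_lipschitz_itv a b f : a < b -> (forall x, derivable f x 1) ->
  continuous (f^`())%classic ->
  exists K, lipschitz_itv K a b f.
Proof.
move=> ab df cf.
have cnf : {within `[a, b], continuous (fun x => `|(f^`())%classic x|)}.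
  by apply: continuous_subspaceT => x; apply: cvg_norm; exact: cf.
have [c _ cM] := EVT_max (ltW ab) cnf.
exists `|(f^`())%classic c|.
move=> x y ax; rewrite le_eqVlt => /predU1P[->|xy] yb.
  by rewrite !subrr normr0 mulr0.
have dfx z : z \in `]x, y[ -> is_derive z 1 f ((f^`())%classic z).
  by move=> _; rewrite derive1E; exact/derivableP.
have cfx : {within `[x, y], continuous f}.
  exact/continuous_subspaceT/derivable_continuous.
have [z zxy ->] := MVT xy dfx cfx.
rewrite normrM [`|y - x|]gtr0_norm ?subr_gt0//; apply: ler_wpM2r.
  by rewrite subr_ge0 ltW.
move: zxy; rewrite in_itv/= => /andP[xz zy].
by apply: cM; rewrite in_itv/= (le_trans ax) ?(le_trans _ yb)// ltW.
Qed.

Lemma derive1_out (S : set R) f : closed S -> (forall x, ~ S x -> f x = 0) ->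
  forall x, ~ S x -> (f^`())%classic x = 0.
Proof.
move=> cS f0 x Sx; rewrite derive1E.
have oS : open (~` S) by exact: closed_openC.
have : \near x, cst 0 x = f x.
  near=> y; rewrite f0//; near: y.
  exact: (oS _ Sx).
by move=> /near_eq_is_derive /(_ (is_derive_cst 0 x 1))[_ ->].
Unshelve. all: by end_near. Qed.

(** Vanishing off a compact subset [S] of [Omega] bounds the support, because
    [S] is closed. *)
Lemma test_functionP (S : set R) Omega phi : (forall n, smoothn n phi) ->
  compact S -> S `<=` Omega -> (forall x, ~ S x -> phi x = 0) ->
  test_function Omega phi.
Proof.
move=> sphi cS SO phi0.
have clS : closed S by apply: compact_closed => //; exact: Rhausdorff.
have sub : closed_support phi `<=` S.
  rewrite /closed_support [X in _ `<=` X]((closure_id _).1 clS).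
  by apply: closure_subset => x /= /eqP; apply: contra_notP => /phi0.
split; first exact: smoothn_derivable.
- by apply: (subclosed_compact _ cS sub); exact: closed_closure.
- exact: subset_trans sub SO.
Qed.

Lemma closed_support_out phi x : ~ closed_support phi x -> phi x = 0.
Proof. by apply: contra_notP => /eqP px; exact: subset_closure. Qed.

Lemma closed_support_derive_out phi x :
  ~ closed_support phi x -> (phi^`())%classic x = 0.
Proof.
apply: derive1_out; first exact: closed_closure.
by move=> y; exact: closed_support_out.
Qed.

Lemma test_function_out Omega phi x : test_function Omega phi -> ~ Omega x -> phi x = 0.
Proof. by move=> [_ _ SO] Ox; apply: closed_support_out => /SO. Qed.

Lemma test_function_derive_out Omega phi x :
  test_function Omega phi -> ~ Omega x -> (phi^`())%classic x = 0.
Proof. by move=> [_ _ SO] Ox; apply: closed_support_derive_out => /SO. Qed.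

Lemma test_function_is_derive Omega phi x : test_function Omega phi ->
  is_derive x 1 phi ((phi^`())%classic x).
Proof. by move=> [/(_ 0%N x) dphi _ _]; rewrite derive1E; exact/derivableP. Qed.

Lemma test_function_continuous Omega phi : test_function Omega phi -> continuous phi.
Proof. by move=> [sphi _ _]; apply: derivable_continuous; exact: (sphi 0%N). Qed.

Lemma test_function_derive_continuous Omega phi :
  test_function Omega phi -> continuous (phi^`())%classic.
Proof. by move=> [sphi _ _]; apply: derivable_continuous; exact: (sphi 1%N). Qed.

Lemma test_function_derive_measurable Omega phi (D : set R) :
  test_function Omega phi -> measurable_fun D (phi^`())%classic.
Proof.
move=> tphi; apply: measurable_funTS; apply: continuous_measurable_fun.
exact: test_function_derive_continuous tphi.
Qed.

Lemma test_function_lipschitz Omega phi a b : a < b -> test_function Omega phi ->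
  exists K, lipschitz_itv K a b phi.
Proof.
move=> ab tphi; have [sphi _ _] := tphi.
have cphi := test_function_derive_continuous tphi.
exact: C1_lipschitz_itv (sphi 0%N) cphi.
Qed.

(** A locally integrable function is only integrable on compact sets, so the
    product is integrated over the support of [psi]. *)
Lemma integrable_loc_mul Omega (S : set R) v psi : locally_integrable Omega v ->
  compact S -> S `<=` Omega -> continuous psi -> (forall x, ~ S x -> psi x = 0) ->
  mu.-integrable Omega (EFin \o (v \* psi)).
Proof.
move=> [mv oO lv] cS SO cpsi psi0.
have mO : measurable Omega by exact: open_measurable.
have mS : measurable S by exact: compact_measurable.
have iS : mu.-integrable S (EFin \o (v \* psi)).
  have -> : EFin \o (v \* psi) = ((EFin \o v) \* (EFin \o psi))%E by apply/funext.
  apply: integrableMl => //.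
  - apply/integrableP; split; last exact: lv.
    by apply/measurable_EFinP; exact: measurable_funS mv.
  - by apply: measurable_funTS; exact: continuous_measurable_fun.
  - have := compact_bounded (continuous_compact (continuous_subspaceT cpsi) cS).
    by move=> [M [Mr MS]]; exists M; split => // N MN x Sx; apply: (MS _ MN); exists x.
have := iS; rewrite -{1}(setIidr SO) => /(integrable_restrict mu mS mO _).1.
apply: eq_integrable => // x _; rewrite patchE /=; case: ifPn => // /negP xS.
by rewrite psi0 ?mulr0// => Sx; apply: xS; rewrite inE.
Qed.

Lemma integrable_mul_test Omega v phi : locally_integrable Omega v ->
  test_function Omega phi -> mu.-integrable Omega (EFin \o (v \* phi)).
Proof.
move=> lv tphi; have [_ cS SO] := tphi; apply: (integrable_loc_mul lv cS) => //.
- exact: test_function_continuous tphi.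
- by move=> x; exact: closed_support_out.
Qed.

Lemma integrable_mul_test_derive Omega v phi : locally_integrable Omega v ->
  test_function Omega phi -> mu.-integrable Omega (EFin \o (v \* (phi^`())%classic)).
Proof.
move=> lv tphi; have [_ cS SO] := tphi; apply: (integrable_loc_mul lv cS) => //.
- exact: test_function_derive_continuous tphi.
- by move=> x; exact: closed_support_derive_out.
Qed.

Lemma is_weak_derivativeD Omega u1 u2 v1 v2 :
  is_weak_derivative Omega u1 v1 -> is_weak_derivative Omega u2 v2 ->
  is_weak_derivative Omega (u1 \+ u2) (v1 \+ v2).
Proof.
move=> [lu1 lv1 e1] [lu2 lv2 e2]; split; [exact: locally_integrableD..|].
move=> phi tphi; have mO : measurable Omega by apply: open_measurable; case: lu1.
transitivity (\int[mu]_(x in Omega) (u1 x * (phi^`())%classic x + u2 x * (phi^`())%classic x)).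
  by apply: eq_Rintegral => x _; rewrite /= mulrDl.
rewrite RintegralD//; [|exact: integrable_mul_test_derive..].
rewrite e1// e2// -opprD -RintegralD//; [|exact: integrable_mul_test..].
by congr (- _); apply: eq_Rintegral => x _; rewrite /= mulrDl.
Qed.

Lemma is_weak_derivativeN Omega u v :
  is_weak_derivative Omega u v -> is_weak_derivative Omega (\- u) (\- v).
Proof.
move=> [lu lv e]; split; [exact: locally_integrableN..|].
move=> phi tphi; have mO : measurable Omega by apply: open_measurable; case: lu.
have N w psi : mu.-integrable Omega (EFin \o (w \* psi)) ->
    \int[mu]_(x in Omega) ((\- w) x * psi x) = - \int[mu]_(x in Omega) (w x * psi x).
  move=> iw; rewrite -mulN1r -RintegralZl//.
  by apply: eq_Rintegral => x _; rewrite /= mulN1r mulNr.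
rewrite N; last exact: integrable_mul_test_derive.
by rewrite N ?e//; exact: integrable_mul_test.
Qed.

Lemma is_weak_derivativeB Omega u1 u2 v1 v2 :
  is_weak_derivative Omega u1 v1 -> is_weak_derivative Omega u2 v2 ->
  is_weak_derivative Omega (u1 \- u2) (v1 \- v2).
Proof. by move=> d1 d2; apply: is_weak_derivativeD => //; exact: is_weak_derivativeN. Qed.

Lemma eq_locally_integrable Omega f g : {in Omega, f =1 g} ->
  locally_integrable Omega f -> locally_integrable Omega g.
Proof.
move=> fg [mf oO lf]; split => //; first exact: eq_measurable_fun mf.
move=> K KO cK; under eq_integral.
  move=> x; rewrite inE => Kx; rewrite -fg; last by rewrite inE; exact: KO.
  over.
exact: lf.
Qed.

Lemma eq_is_weak_derivative Omega u1 u2 v1 v2 : {in Omega, u1 =1 u2} ->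
  {in Omega, v1 =1 v2} -> is_weak_derivative Omega u1 v1 ->
  is_weak_derivative Omega u2 v2.
Proof.
move=> u12 v12 [lu lv e]; split; [exact: eq_locally_integrable lu|exact: eq_locally_integrable lv|].
move=> phi tphi.
transitivity (\int[mu]_(x in Omega) (u1 x * (phi^`())%classic x)).
  by apply: eq_Rintegral => x xO; rewrite u12.
by rewrite e//; congr (- _); apply: eq_Rintegral => x xO; rewrite v12.
Qed.

Lemma eq_weak_derivative Omega u1 u2 : {in Omega, u1 =1 u2} ->
  weak_derivative Omega u1 = weak_derivative Omega u2.
Proof.
move=> u12; rewrite /weak_derivative; congr xget; apply/seteqP; split => v /=;
  by apply: eq_is_weak_derivative => // x xO; rewrite u12.
Qed.

End weak_derivatives.

(** * Uniqueness of weak derivatives *)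

Section weak_uniqueness.
Context {R : realType}.
Notation mu := (@lebesgue_measure R).
Implicit Types (Omega : set R) (f g h u v phi psi : R -> R) (a b c d x : R).

Lemma test_function_bump Omega s c d : 0 < s -> c < d ->
  (forall x, c <= x <= d -> Omega x) -> test_function Omega (smooth_bump s c d).
Proof.
move=> s0 cd cdO; apply: (@test_functionP _ `[c, d]%classic) => //.
- by move=> n; exact: smoothn_smooth_bump.
- exact: segment_compact.
move=> x; rewrite /= in_itv/= => /negP xcd; apply: smooth_bump_out => //.
by apply: contra xcd => /andP[cx xd]; rewrite !ltW.
Qed.

Lemma Rintegral_sub_out (A B : set R) f : B `<=` A -> (forall x, A x -> ~ B x -> f x = 0) ->
  \int[mu]_(x in A) f x = \int[mu]_(x in B) f x.
Proof.
move=> BA f0; rewrite -[in RHS](setIidr BA) Rintegral_mkcondr.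
apply: eq_Rintegral => x; rewrite inE => Ax; rewrite patchE; case: ifPn => // /negP xB.
by rewrite f0// => Bx; apply: xB; rewrite inE.
Qed.

(** The bumps tend to the indicator of [`]c, d[] boundedly, so dominated
    convergence passes from bumps to intervals. *)
Lemma integral_bump_eq0 Omega h c d : locally_integrable Omega h -> c < d ->
  (forall x, c <= x <= d -> Omega x) ->
  (forall n, \int[mu]_(x in Omega) (h x * smooth_bump n.+1%:R c d x) = 0) ->
  \int[mu]_(x in `]c, d[) h x = 0.
Proof.
move=> [mh oO lh] cd cdO h0.
have cdO' : `]c, d[%classic `<=` Omega.
  by move=> x /=; rewrite in_itv/= => /andP[cx xd]; apply: cdO; rewrite !ltW.
have ih : mu.-integrable `]c, d[ (EFin \o h).
  apply: (@integrableS _ _ _ mu `[c, d]) => //; first exact: subset_itv_oo_cc.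
  apply/integrableP; split.
    apply/measurable_EFinP; apply: measurable_funS mh; first exact: open_measurable.
    by move=> x /=; rewrite in_itv/= => /cdO.
  by apply: lh => [x /=|]; [rewrite in_itv/= => /cdO|exact: segment_compact].
have mbump n : measurable_fun `]c, d[ (smooth_bump n.+1%:R c d).
  apply: measurable_funTS; apply: continuous_measurable_fun.
  apply: derivable_continuous => x.
  have := @smoothn_derivable _ (smooth_bump n.+1%:R c d) _ 0%N x; apply => m.
  exact: smoothn_smooth_bump.
have mhI : measurable_fun `]c, d[ h by case/integrableP: ih => /measurable_EFinP.
have : (\int[mu]_(x in `]c, d[) (h x * smooth_bump n.+1%:R c d x)%:E)%E @[n --> \oo] -->
    (\int[mu]_(x in `]c, d[) (h x)%:E)%E.
  apply: (@dominated_cvg _ _ _ mu `]c, d[%classic _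
    (fun n x => (h x * smooth_bump n.+1%:R c d x)%:E) (EFin \o h) (fun x => `|h x|%:E)) => //.
  - by move=> n; apply/measurable_EFinP; exact: measurable_funM mhI (mbump n).
  - move=> x; rewrite /= in_itv/= => xcd; apply: cvg_EFin; first exact: nearW.
    by rewrite -[X in _ --> X]mulr1; apply: cvgMr; exact: smooth_bump_cvg.
  - exact: integrable_abse ih.
  - move=> n x _; rewrite lee_fin normrM ler_piMr// ger0_norm ?smooth_bump_ge0//.
    exact: smooth_bump_le1.
have E n : (\int[mu]_(x in `]c, d[) (h x * smooth_bump n.+1%:R c d x)%:E = 0)%E.
  have fn : (\int[mu]_(x in `]c, d[) (h x * smooth_bump n.+1%:R c d x)%:E)%E \is a fin_num.
    apply: integrable_fin_num => //=.
    apply: (@integrableS _ _ _ mu Omega) => //; first exact: open_measurable.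
    by apply: integrable_mul_test => //; exact: test_function_bump.
  rewrite -(fineK fn); congr EFin; rewrite -[RHS](h0 n).
  rewrite (Rintegral_sub_out cdO')// => x Ox; rewrite /= in_itv/= => /negP xcd.
  by rewrite smooth_bump_out ?mulr0// ltr0n.
under eq_fun do rewrite E.
by move=> /(cvg_lim (@ereal_hausdorff R)); rewrite lim_cst// /Rintegral => <-.
Qed.

(** The integral of [h] vanishes over every interval compactly contained in
    [Omega], so the zero function is a primitive of [h] there, and [h] is its
    derivative at almost every point. *)
Lemma ae_eq0_weak Omega h : locally_integrable Omega h ->
  (forall phi, test_function Omega phi -> \int[mu]_(x in Omega) (h x * phi x) = 0) ->
  {ae mu, forall x, Omega x -> h x = 0}.
Proof.
move=> lh h0; have [mh oO lh'] := lh.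
have aeF := ae_filter_ringOfSetsType mu.
have h0cd (c d : R) : c < d -> (forall x, c <= x <= d -> Omega x) ->
    {ae mu, forall x, c < x < d -> h x = 0}.
  move=> cd cdO.
  have ih : mu.-integrable `[c, d] (EFin \o h).
    apply/integrableP; split.
      apply/measurable_EFinP; apply: measurable_funS mh; first exact: open_measurable.
      by move=> x /=; rewrite in_itv/= => /cdO.
    by apply: lh' => [x /=|]; [rewrite in_itv/= => /cdO|exact: segment_compact].
  have : {ae mu, forall x, c < x < d -> is_derive x 1 (cst 0 : R -> R) (h x)}.
    apply: ae_is_derive_primitive => // x /andP[cx xd]; rewrite subr0.
    move: cx; rewrite le_eqVlt => /predU1P[<-|cx]; first by rewrite set_itv1 Rintegral_set1.
    have cxO y : c <= y <= x -> Omega y.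
      by move=> /andP[cy yx]; apply: cdO; rewrite cy (le_trans yx).
    have ix : mu.-integrable `[c, x] (EFin \o h).
      apply: integrableS ih => //; apply: subset_itvl; rewrite bnd_simp//.
    rewrite -Rintegral_itv_obnd_cbnd; last first.
      by apply: integrableS ix => //; exact: subset_itv_oc_cc.
    rewrite -Rintegral_itv_bndo_bndc; last first.
      by apply: integrableS ix => //; exact: subset_itv_oo_cc.
    apply: (integral_bump_eq0 lh) => // n; apply: h0; exact: test_function_bump.
  apply: (@filterS _ _ aeF) => x hx xcd.
  exact: is_derive_unique (hx xcd) (is_derive_cst 0 x 1).
(* [Omega] is exhausted by the countably many intervals with rational ends that
   it contains; [n] encodes a pair of ends. *)
pose P (n : nat) x := if unpickle n is Some (c, d) then
  (ratr c < x < ratr d -> (forall y : R, ratr c <= y <= ratr d -> Omega y) -> h x = 0) else True.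
have : {ae mu, forall x n, P n x}.
  apply: ae_foralln => n; rewrite /P; case: unpickle => [[c d]|]; last exact: aeW.
  have [cdO|ncdO] := pselect (forall y : R, ratr c <= y <= ratr d -> Omega y); last first.
    exact: aeW.
  have [cd|dc] := ltP (ratr c : R) (ratr d).
    by apply: (@filterS _ _ aeF _ _ _ (h0cd _ _ cd cdO)) => x hx xcd _; exact: hx.
  by apply: aeW => x /andP[cx xd]; have := lt_trans cx xd; rewrite ltNge dc.
apply: (@filterS _ _ aeF) => x hP Ox.
have /nbhs_ballP[e /= e0 eO] := oO _ Ox.
have [c] : exists c : rat, ratr c \in `]x - e, x[ by have /rat_in_itvoo : x - e < x by lra.
have [d] : exists d : rat, ratr d \in `]x, x + e[ by have /rat_in_itvoo : x < x + e by lra.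
rewrite !in_itv/= => /andP[xd dx] /andP[xc cx].
have := hP (pickle (c, d)); rewrite /P pickleK; apply; first by rewrite cx xd.
move=> y /andP[cy yd]; apply: eO; rewrite /ball/= ltr_norml; apply/andP; split; lra.
Qed.

Lemma weak_derivative_unique Omega u v1 v2 :
  is_weak_derivative Omega u v1 -> is_weak_derivative Omega u v2 ->
  {ae mu, forall x, Omega x -> v1 x = v2 x}.
Proof.
move=> [_ lv1 e1] [_ lv2 e2].
have oO : open Omega by case: lv1.
have mO := open_measurable oO.
have aeF := ae_filter_ringOfSetsType mu.
have := @ae_eq0_weak Omega (v1 \- v2) (locally_integrableB lv1 lv2).
move=> H; have : {ae mu, forall x, Omega x -> (v1 \- v2) x = 0}.
  apply: H => phi tphi.
  transitivity (\int[mu]_(x in Omega) (v1 x * phi x - v2 x * phi x)).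
    by apply: eq_Rintegral => x _; rewrite /= mulrBl.
  rewrite RintegralB//; [|exact: integrable_mul_test..].
  by apply/eqP; rewrite subr_eq0 -eqr_opp -e1// -e2.
by apply: (@filterS _ _ aeF) => x h /h /= /eqP; rewrite subr_eq0 => /eqP.
Qed.

(** [weak_derivative] is a chosen representative, so it is only known up to a
    null set: this is how every concrete weak derivative is compared with it. *)
Lemma weak_derivativeP Omega u v : is_weak_derivative Omega u v ->
  is_weak_derivative Omega u (weak_derivative Omega u) /\
  {ae mu, forall x, Omega x -> weak_derivative Omega u x = v x}.
Proof.
move=> uv; have H : is_weak_derivative Omega u (weak_derivative Omega u).
  by rewrite /weak_derivative; apply: xgetPex; exists v.
by split => //; exact: weak_derivative_unique H uv.
Qed.

(** Integration by parts on [[a, b]]: a test function of [Omega] vanishes at the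
    ends, and it contributes nothing to the integrals off [Omega]. *)
Lemma lipschitz_weak_derivative Omega a b C u g : a < b -> open Omega ->
  (forall x, Omega x -> a < x < b) -> lipschitz_itv C a b u ->
  measurable_fun `[a, b] g ->
  {ae mu, forall x, a < x < b -> is_derive x 1 u (g x)} ->
  is_weak_derivative Omega u g.
Proof.
move=> ab oO Oab lu mg dg; have mO := open_measurable oO.
have Oab' : Omega `<=` `[a, b].
  by move=> x /Oab /andP[ax xb]; rewrite /= in_itv/= !ltW.
have [ig _] := lipschitz_FTC ab lu mg dg.
have iu : mu.-integrable `[a, b] (EFin \o u).
  apply: continuous_compact_integrable; first exact: segment_compact.
  exact: lipschitz_itv_continuous lu.
split; [apply: open_integrable_locally => //..|].
- exact: integrableS iu.
- exact: integrableS ig.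
move=> phi tphi.
have [K lphi] := test_function_lipschitz ab tphi.
rewrite -(Rintegral_sub_out Oab'); last first.
  by move=> x _ xO; rewrite (test_function_derive_out tphi) ?mulr0.
rewrite -(Rintegral_sub_out Oab'); last first.
  by move=> x _ xO; rewrite (test_function_out tphi) ?mulr0.
apply: (lipschitz_ibp ab lu lphi mg) => //.
- exact: test_function_derive_measurable tphi.
- by apply: aeW => x _; exact: test_function_is_derive tphi.
- by apply: (test_function_out tphi) => /Oab; rewrite ltxx.
- by apply: (test_function_out tphi) => /Oab; rewrite ltxx andbF.
Qed.

End weak_uniqueness.

(** * Components of an open set of the line *)

Section components.
Context {R : realType}.
Implicit Types (Omega : set R) (a b l r x y : R).

(** The left end of the component of [x]; it is [x] itself when [x] lies outside
    [Omega], which makes the constructions below agree with the boundary data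
    there without a case distinction. *)
Definition lft Omega x : R := sup [set y | y <= x /\ ~ Omega y].

Lemma lftP Omega a x : open Omega -> a <= x -> ~ Omega a ->
  [/\ lft Omega x <= x, ~ Omega (lft Omega x) &
      forall y, lft Omega x < y -> y <= x -> Omega y].
Proof.
move=> oO ax Oa; set S := [set y | y <= x /\ ~ Omega y].
have S0 : has_sup S by split; [exists a|exists x => y []].
split.
- by apply: ge_sup => //; [exists a|move=> y []].
- move=> Ol; have /nbhs_ballP[e /= e0 eO] := oO _ Ol.
  have [y [yx Oy] ly] := sup_adherent e0 S0.
  apply: (Oy); apply: eO; rewrite /ball/= ger0_norm.
    by move: ly; rewrite /lft; lra.
  by rewrite subr_ge0; exact: (sup_ubound S0.2 (conj yx Oy)).
- move=> y ly yx; apply: contrapT => Oy; move: ly; rewrite ltNge => /negP; apply.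
  exact: (sup_ubound S0.2 (conj yx Oy)).
Qed.

Lemma lft_eq Omega l x : open Omega -> l <= x -> ~ Omega l ->
  (forall y, l < y -> y <= x -> Omega y) -> lft Omega x = l.
Proof.
move=> oO lx Ol lO; have [h1 h2 h3] := lftP oO lx Ol.
apply/eqP; rewrite eq_le !leNgt; apply/andP; split; apply/negP => h.
  by apply: h2; exact: lO.
by apply: Ol; exact: h3.
Qed.

Definition rgt Omega x : R := - lft [set y | Omega (- y)] (- x).

Lemma open_opp Omega : open Omega -> open [set y | Omega (- y)].
Proof. by move=> oO; apply: (open_comp _ oO) => x _; exact: oppr_continuous. Qed.

Lemma rgtP Omega b x : open Omega -> x <= b -> ~ Omega b ->
  [/\ x <= rgt Omega x, ~ Omega (rgt Omega x) &
      forall y, x <= y -> y < rgt Omega x -> Omega y].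
Proof.
move=> oO xb Ob; have nb : - b <= - x by rewrite lerN2.
have Ob' : ~ [set y | Omega (- y)] (- b) by rewrite /= opprK.
have [h1 h2 h3] := lftP (open_opp oO) nb Ob'; split.
- by rewrite /rgt lerNr.
- exact: h2.
- by move=> y xy yr; have /= := h3 (- y); rewrite opprK; apply; [rewrite ltrNr|rewrite lerN2].
Qed.

Lemma rgt_eq Omega r x : open Omega -> x <= r -> ~ Omega r ->
  (forall y, x <= y -> y < r -> Omega y) -> rgt Omega x = r.
Proof.
move=> oO xr Or rO; rewrite /rgt -[RHS]opprK; congr (- _).
apply: lft_eq; [exact: open_opp|by rewrite lerN2|by rewrite /= opprK|].
by move=> y ry yx; apply: rO; [rewrite lerNr|rewrite ltrNl].
Qed.

(** A point of the complement between [x] and [y] splits the increment into two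
    pieces: [w] vanishes at the first such point after [x] and at the last one
    before [y], so only the two end pieces, which lie in [Omega], count. *)
Lemma lipschitz_glue Omega C (w : R -> R) a b : 0 <= C -> open Omega ->
  ~ Omega a -> ~ Omega b ->
  (forall x, ~ Omega x -> w x = 0) ->
  (forall x y, x < y -> (forall z, x < z < y -> Omega z) -> `|w y - w x| <= C * (y - x)) ->
  lipschitz_itv C a b w.
Proof.
move=> C0 oO Oa Ob w0 wl x y ax; rewrite le_eqVlt => /predU1P[->|xy] yb.
  by rewrite !subrr normr0 mulr0.
have [xyO|] := pselect (forall z, x < z < y -> Omega z); first exact: wl.
move/existsNP => [z /not_implyP[/andP[xz zy] Oz]].
have [h1 h2 h3] := rgtP oO (ltW xz) Oz.
have [k1 k2 k3] := lftP oO (ltW zy) Oz.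
have rz : rgt Omega x <= z.
  by rewrite leNgt; apply/negP => h; apply: Oz; apply: h3 => //; exact: ltW.
have zl : z <= lft Omega y.
  by rewrite leNgt; apply/negP => h; apply: Oz; apply: k3 => //; exact: ltW.
have l1 : `|w x| <= C * (rgt Omega x - x).
  have [xr|rx] := ltP x (rgt Omega x); last first.
    have xE : rgt Omega x = x by apply/eqP; rewrite eq_le h1 rx.
    by rewrite xE in h2 *; rewrite w0// normr0 subrr mulr0.
  have := wl x _ xr; rewrite (w0 _ h2) sub0r normrN; apply.
  by move=> u /andP[xu ur]; apply: h3 => //; exact: ltW.
have l2 : `|w y| <= C * (y - lft Omega y).
  have [ly|yl] := ltP (lft Omega y) y; last first.
    have yE : lft Omega y = y by apply/eqP; rewrite eq_le k1 yl.
    by rewrite yE in k2 *; rewrite w0// normr0 subrr mulr0.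
  have := wl _ y ly; rewrite (w0 _ k2) subr0; apply.
  by move=> u /andP[lu uy]; apply: k3 => //; exact: ltW.
apply: (le_trans (ler_normB _ _)).
have : C * (rgt Omega x - x) + C * (y - lft Omega y) <= C * (y - x).
  by rewrite -mulrDr; apply: ler_wpM2l => //; lra.
lra.
Qed.

End components.

(** * Mollification *)

Section mollification.
Context {R : realType}.
Notation mu := (@lebesgue_measure R).
Implicit Types (Omega : set R) (f g h u v phi psi B W : R -> R) (a b c d r x y z K L : R).

Lemma ge0_subset_Rintegral (A B : set R) f : measurable A -> measurable B ->
  mu.-integrable B (EFin \o f) -> (forall x, B x -> 0 <= f x) -> A `<=` B ->
  \int[mu]_(x in A) f x <= \int[mu]_(x in B) f x.
Proof.
move=> mA mB fB f0 AB; have fA : mu.-integrable A (EFin \o f) by exact: integrableS fB.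
rewrite /Rintegral; apply: fine_le; [exact: integrable_fin_num|exact: integrable_fin_num|].
apply: ge0_subset_integral => //; exact: measurable_int fB.
Qed.

Definition smooth_cpt B :=
  (forall n, smoothn n B) /\ exists r, forall x, r < `|x| -> B x = 0.

Lemma smooth_cpt_derive B : smooth_cpt B -> smooth_cpt (B^`())%classic.
Proof.
move=> [sB [r Br]]; split; first by move=> n; exact: (sB n.+1).2.
exists r => x rx.
have := @derive1_out _ [set y | `|y| <= r] B; apply.
- have /continuous_closedP : continuous (fun y : R => `|y|) by exact: norm_continuous.
  by move=> /(_ [set y | y <= r] (@closed_le _ r)).
- by move=> y /= /negP; rewrite -ltNge; exact: Br.
- by apply/negP; rewrite -ltNge.
Qed.

Lemma smooth_cpt_continuous B : smooth_cpt B -> continuous B.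
Proof. by move=> [sB _]; apply: derivable_continuous; exact: (sB 1%N).1. Qed.

Lemma smooth_cpt_bounded B : smooth_cpt B -> exists K, forall x, `|B x| <= K.
Proof.
move=> sB; have cB := smooth_cpt_continuous sB; have [_ [r Br]] := sB.
have cnB : {within `[- `|r|, `|r|], continuous (fun x => `|B x|)}.
  by apply: continuous_subspaceT => x; apply: cvg_norm; exact: cB.
have rr : - `|r| <= `|r| by rewrite -subr_ge0 opprK addr_ge0.
have [c _ cM] := EVT_max rr cnB.
exists `|B c| => x; have [xr|rx] := leP `|x| `|r|.
  by apply: cM; rewrite in_itv/= -ler_norml.
by rewrite Br ?normr0// (le_lt_trans (ler_norm r)).
Qed.

(** The convolution with [B] of the restriction of [W] to [[a, b]]. *)
Definition mollify a b W B x : R := \int[mu]_(y in `[a, b]) (W y * B (x - y)).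

Lemma integrable_mollify a b W B x K : measurable_fun `[a, b] W ->
  (forall y, y \in `[a, b] -> `|W y| <= K) -> smooth_cpt B ->
  mu.-integrable `[a, b] (EFin \o (fun y => W y * B (x - y))).
Proof.
move=> mW WK sB; have [L BL] := smooth_cpt_bounded sB.
have K0 y : y \in `[a, b] -> 0 <= K by move=> /WK; apply: le_trans.
apply: (@bounded_integrable _ _ _ (K * L)) => //; first exact: itv_measure_lty.
  apply: measurable_funM => //; apply: measurable_funTS.
  apply: continuous_measurable_fun => y.
  apply: continuous_comp; last exact: smooth_cpt_continuous.
  by apply: cvgB; [exact: cvg_cst|exact: cvg_id].
by move=> y yab; rewrite normrM; apply: ler_pM => //; exact: WK.
Qed.

(** Differentiation under the integral sign: the derivative of the integrand is
    dominated by a multiple of [`|W|]. *)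
Lemma is_derive_mollify a b W B x K : measurable_fun `[a, b] W ->
  (forall y, y \in `[a, b] -> `|W y| <= K) -> smooth_cpt B ->
  is_derive x 1 (mollify a b W B) (mollify a b W (B^`())%classic x).
Proof.
move=> mW WK sB; have [L BL] := smooth_cpt_bounded (smooth_cpt_derive sB).
have dB z y : is_derive z 1 (fun z : R => W y * B (z - y)) (W y * (B^`())%classic (z - y)).
  have [sB' _] := sB; have dBz := smoothn_is_derive (sB' 1%N) (z - y).
  have dz : is_derive z 1 (fun z : R => z - y) 1.
    have := is_deriveB (is_derive_id z 1) (is_derive_cst y z 1).
    by move/is_derive_eq; apply; rewrite subr0.
  have := is_deriveZ (W y) (@is_derive1_comp _ B (fun z => z - y) _ _ _ dBz dz).
  by move/is_derive_eq; apply; rewrite mulr1.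
have L0 : 0 <= L by apply: le_trans (BL 0).
have p1 z y : partial1of2 (fun z y => W y * B (z - y)) z y = W y * (B^`())%classic (z - y).
  by rewrite partial1of2E; case: (dB z y).
have xI : `]x - 1, x + 1[%classic x by rewrite /= in_itv/=; apply/andP; split; lra.
have iF z : `]x - 1, x + 1[%classic z ->
    mu.-integrable `[a, b] (EFin \o (fun y => W y * B (z - y))).
  by move=> _; exact: integrable_mollify WK sB.
have dF z y : `]x - 1, x + 1[%classic z -> `[a, b]%classic y ->
   derivable (fun z => W y * B (z - y)) z 1 by move=> _ _; case: (dB z y).
have G0 y : 0 <= `|W y| * L by rewrite mulr_ge0.
have iG : mu.-integrable `[a, b] (EFin \o (fun y => `|W y| * L)).
  apply: (@bounded_integrable _ _ _ (K * L)) => //; first exact: itv_measure_lty.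
    by apply: measurable_funM => //; exact: measurableT_comp.
  by move=> y yab; rewrite normrM normr_id ger0_norm//; apply: ler_wpM2r => //; exact: WK.
have Gub z y : `]x - 1, x + 1[%classic z -> `[a, b]%classic y ->
    `|partial1of2 (fun z y => W y * B (z - y)) z y| <= `|W y| * L.
  by move=> _ _; rewrite p1 normrM; apply: ler_wpM2l.
have mab : measurable (`[a, b]%classic : set (measurableTypeR R)) by [].
apply: DeriveDef.
  exact: (derivable_under_integral mab xI iF dF G0 iG Gub).
rewrite -derive1E.
rewrite [LHS](differentiation_under_integral mab xI iF dF G0 iG Gub).
by apply: eq_Rintegral => y _; rewrite p1.
Qed.

Lemma smoothn_mollify n a b W B K : measurable_fun `[a, b] W ->
  (forall y, y \in `[a, b] -> `|W y| <= K) -> smooth_cpt B ->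
  smoothn n (mollify a b W B).
Proof.
move=> mW WK; elim: n B => // n ih B sB.
apply: (@smoothnS _ _ _ (mollify a b W (B^`())%classic)).
  by move=> x; exact: is_derive_mollify WK sB.
by apply: ih; exact: smooth_cpt_derive.
Qed.

(** Not normalised to have integral one: only a lower bound on its mass is
    available, see [mollifier_mass_ge]. *)
Definition mollifier r : R -> R := smooth_bump r^-1 (- r) r.

Lemma mollifier_out r y : 0 < r -> r <= `|y| -> mollifier r y = 0.
Proof.
move=> r0 ry; apply: smooth_bump_out; first by rewrite invr_gt0.
by rewrite -ltr_norml -leNgt.
Qed.

Lemma smooth_cpt_mollifier r : 0 < r -> smooth_cpt (mollifier r).
Proof.
move=> r0; split; first by move=> n; exact: smoothn_smooth_bump.
by exists r => x /ltW; exact: mollifier_out.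
Qed.

Lemma mollifierN r y : mollifier r (- y) = mollifier r y.
Proof. by rewrite /mollifier /smooth_bump mulrC; congr (flat 0 (_ * _) * flat 0 (_ * _)); ring. Qed.

Definition mollifier_mass r : R := \int[mu]_(y in `[(- r), r]) mollifier r y.

Lemma continuous_mollifier r : 0 < r -> continuous (mollifier r).
Proof. by move=> r0; apply: smooth_cpt_continuous; exact: smooth_cpt_mollifier. Qed.

Lemma integrable_mollifier r c d : 0 < r -> mu.-integrable `[c, d] (EFin \o mollifier r).
Proof.
move=> r0; apply: continuous_compact_integrable; first exact: segment_compact.
by apply: continuous_subspaceT; exact: continuous_mollifier.
Qed.

(** On the middle half of the support both factors of the bump have an argument
    at least [1/2], hence a value at least [exp(-2)]. A mass of the order of [r]
    makes mollification comparable with the mean over a ball of radius [r]. *)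
Lemma mollifier_mass_ge r : 0 < r -> r * expR (- 4) <= mollifier_mass r.
Proof.
move=> r0; set c := r / 2.
have c0 : 0 < c by rewrite /c; lra.
apply: (@le_trans _ _ (\int[mu]_(y in `[(- c), c]) mollifier r y)).
  have -> : r * expR (- 4) = \int[mu]_(y in `[(- c), c]) (cst (expR (- 4)) y).
    rewrite Rintegral_cst//= lebesgue_measure_itv/= lte_fin.
    have -> : - c < c by lra.
    by rewrite mulrC /= opprK /c; congr (_ * _); lra.
  apply: le_Rintegral => //.
  - apply: (@bounded_integrable _ _ _ (expR (- 4))) => //; first exact: itv_measure_lty.
    by move=> y _; rewrite /= ger0_norm ?expR_ge0.
  - exact: integrable_mollifier.
  move=> y /=; rewrite in_itv/= => /andP[cy yc].
  have h z : c <= z -> expR (- 2) <= flat 0 (r^-1 * z).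
    move=> cz; rewrite /flat mulr_gt0 ?invr_gt0 ?(lt_le_trans c0 cz)// expr0 mul1r ler_expR.
    rewrite lerN2 invfM invrK ler_pdivrMr ?(lt_le_trans c0 cz)//.
    by move: cz; rewrite /c; lra.
  have -> : (- 4 : R) = - 2 + - 2 by lra.
  rewrite expRD /mollifier /smooth_bump; apply: ler_pM; rewrite ?expR_ge0//; apply: h.
    by rewrite /c in cy yc *; lra.
  by rewrite /c in cy yc *; lra.
apply: ge0_subset_Rintegral => //; first exact: integrable_mollifier.
- by move=> y _; exact: smooth_bump_ge0.
- move=> y /=; rewrite !in_itv/= => /andP[cy yc].
  by rewrite /c in cy yc; apply/andP; split; lra.
Qed.

Lemma integral_mollifier r a b x : 0 < r -> a <= x - r -> x + r <= b ->
  \int[mu]_(y in `[a, b]) mollifier r (x - y) = mollifier_mass r.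
Proof.
move=> r0 ax xb.
rewrite (@Rintegral_sub_out _ _ `[x - r, x + r]%classic); last 2 first.
- by apply: subset_itv; rewrite bnd_simp.
- move=> y _; rewrite /= in_itv/= => yxr; apply: mollifier_out => //.
  apply: ltW; rewrite ltNge; apply/negP; rewrite ler_norml => /andP[h1 h2]; apply: yxr.
  by apply/andP; split; lra.
rewrite /mollifier_mass /Rintegral; congr fine.
have -> : x - r = - r + x by ring.
have -> : x + r = r + x by ring.
have dF y : is_derive y 1 (fun y : R => y + x) 1.
  have := is_deriveD (is_derive_id y 1) (is_derive_cst x y 1).
  by move/is_derive_eq; apply; rewrite addr0.
have F' : (fun y : R => y + x)^`()%classic = cst 1.
  by apply/funext => y; rewrite derive1E; case: (dF y).
have cF : continuous (fun y : R => y + x).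
  by apply: derivable_continuous => y; case: (dF y).
rewrite (@integration_by_substitution_increasing R (fun y => y + x)
  (fun y => mollifier r (x - y)) (- r) r).
- apply: eq_integral => y _; rewrite F' !fctE mulr1.
  by rewrite opprD addrCA subrr addr0 mollifierN.
- lra.
- by move=> y z _ _ yz; rewrite ltrD2r.
- by move=> y _; rewrite F'; exact: cvg_cst.
- by rewrite F'; exact: is_cvg_cst.
- by rewrite F'; exact: is_cvg_cst.
- split; first by move=> y _; case: (dF y).
    by apply: cvg_at_right_filter; exact: cF.
  by apply: cvg_at_left_filter; exact: cF.
apply: continuous_subspaceT => y.
apply: (@continuous_comp _ _ _ (fun y : R => x - y) (mollifier r)).
  by apply: cvgB; [exact: cvg_cst|exact: cvg_id].
exact: continuous_mollifier.
Qed.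

End mollification.

Section mollifier_average.
Context {R : realType}.
Notation mu := (@lebesgue_measure R).
Implicit Types (g G : R -> R) (a b c d r x y z K : R).

Lemma mollifier_ge0 r y : 0 <= mollifier r y. Proof. exact: smooth_bump_ge0. Qed.
Lemma mollifier_le1 r y : mollifier r y <= 1. Proof. exact: smooth_bump_le1. Qed.

Lemma mollifier_mass_gt0 r : 0 < r -> 0 < mollifier_mass r.
Proof. by move=> r0; apply: lt_le_trans (mollifier_mass_ge r0); rewrite mulr_gt0// expR_gt0. Qed.

Lemma mollifier_average_le r a b x G K : 0 < r -> a <= x - r -> x + r <= b ->
  measurable_fun `[a, b] G -> (forall y, y \in `[a, b] -> `|G y| <= K) ->
  `|\int[mu]_(y in `[a, b]) (G y * mollifier r (x - y))| <= K * mollifier_mass r.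
Proof.
move=> r0 ax xb mG GK; have ck := smooth_cpt_mollifier r0.
have iGk := integrable_mollify x mG GK ck.
have i1 (L : R) : mu.-integrable `[a, b] (EFin \o (fun y => cst L y * mollifier r (x - y))).
  by apply: (@integrable_mollify _ _ _ _ _ _ `|L|).
have ik1 : mu.-integrable `[a, b] (EFin \o (fun y => mollifier r (x - y))).
  by apply: eq_integrable (i1 1) => // y _; rewrite /= mul1r.
apply: (le_trans (le_normr_Rintegral _ iGk)) => //.
rewrite -(integral_mollifier r0 ax xb) -RintegralZl//.
apply: le_Rintegral => //.
- exact: integrable_abse iGk.
- exact: i1 K.
move=> y yab; rewrite normrM [`|mollifier _ _|]ger0_norm ?mollifier_ge0//.
by apply: ler_wpM2r; [exact: mollifier_ge0|exact: GK].
Qed.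

(** The mollifier is at most [1] and its mass is at least [r exp(-4)], so the
    weighted mean of [G - c] is controlled by the plain mean of [`|G - c|] over
    the ball: mollification converges at Lebesgue points. *)
Lemma mollifier_average_near r a b x G K c : 0 < r -> a <= x - r -> x + r <= b ->
  measurable_fun `[a, b] G -> (forall y, y \in `[a, b] -> `|G y| <= K) ->
  `|(mollifier_mass r)^-1 * \int[mu]_(y in `[a, b]) (G y * mollifier r (x - y)) - c| <=
  expR 4 / r * \int[mu]_(y in ball x r) `|G y - c|.
Proof.
move=> r0 ax xb mG GK; have ck := smooth_cpt_mollifier r0.
have m0 := mollifier_mass_gt0 r0.
have mGc : measurable_fun `[a, b] (fun y => G y - c) by exact: measurable_funB.
have Gc y : y \in `[a, b] -> `|G y - c| <= K + `|c|.
  by move=> /GK h; rewrite (le_trans (ler_normB _ _))// lerD2r.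
have iGk := integrable_mollify x mG GK ck.
have iGck := integrable_mollify x mGc Gc ck.
have ic : mu.-integrable `[a, b] (EFin \o (fun y => cst c y * mollifier r (x - y))).
  by apply: (@integrable_mollify _ _ _ _ _ _ `|c|).
have ik1 : mu.-integrable `[a, b] (EFin \o (fun y => mollifier r (x - y))).
  have : mu.-integrable `[a, b] (EFin \o (fun y => cst 1 y * mollifier r (x - y))).
    by apply: (@integrable_mollify _ _ _ _ _ _ `|1|).
  by apply: eq_integrable => // y _; rewrite /= mul1r.
have -> : (mollifier_mass r)^-1 * \int[mu]_(y in `[a, b]) (G y * mollifier r (x - y)) - c =
    (mollifier_mass r)^-1 * \int[mu]_(y in `[a, b]) ((G y - c) * mollifier r (x - y)).
  have -> : \int[mu]_(y in `[a, b]) ((G y - c) * mollifier r (x - y)) =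
      \int[mu]_(y in `[a, b]) (G y * mollifier r (x - y)) - c * mollifier_mass r.
    rewrite -(integral_mollifier r0 ax xb) -RintegralZl// -RintegralB//.
    by apply: eq_Rintegral => y _; rewrite mulrBl.
  by rewrite mulrBr [c * _]mulrC mulKf ?gt_eqF.
have bab : ball x r `<=` `[a, b].
  by move=> y; rewrite ball_itv /= !in_itv/= => /andP[h1 h2]; apply/andP; split; lra.
have iab : mu.-integrable `[a, b] (EFin \o (fun y => `|G y - c|)).
  apply: (@bounded_integrable _ _ _ (K + `|c|)) => //; first exact: itv_measure_lty.
    exact: measurableT_comp.
  by move=> y yab; rewrite normr_id; exact: Gc.
have I0 : 0 <= \int[mu]_(y in ball x r) `|G y - c| by apply: Rintegral_ge0.
have le1 : `|\int[mu]_(y in `[a, b]) ((G y - c) * mollifier r (x - y))| <=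
    \int[mu]_(y in ball x r) `|G y - c|.
  apply: (le_trans (le_normr_Rintegral _ iGck)) => //.
  rewrite (Rintegral_sub_out bab); last first.
    move=> y _ xy; rewrite mollifier_out ?mulr0 ?normr0//.
    by rewrite leNgt; apply/negP.
  apply: le_Rintegral => //; first exact: measurable_ball.
  - apply: (@integrableS _ _ _ mu `[a, b]) => //; first exact: measurable_ball.
    exact: integrable_abse iGck.
  - by apply: (@integrableS _ _ _ mu `[a, b]) => //; exact: measurable_ball.
  move=> y _; rewrite normrM ler_piMr// ger0_norm ?mollifier_ge0//.
  exact: mollifier_le1.
rewrite normrM gtr0_norm ?invr_gt0//; apply: ler_pM => //.
  by rewrite invr_ge0 ltW.
rewrite -[expR 4]invrK -expRN -invfM lef_pV2 ?posrE// 1?mulrC ?mollifier_mass_ge//.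
by rewrite mulr_gt0// expR_gt0.
Qed.

End mollifier_average.

(** * Distance to the complement, and truncation *)

Section distance.
Context {R : realType}.
Implicit Types (Omega : set R) (c x y z : R).

Definition dist_out Omega x : R := inf [set `|x - y| | y in ~` Omega].

Lemma dist_out_le Omega x y : ~ Omega y -> dist_out Omega x <= `|x - y|.
Proof.
by move=> Oy; apply: ge_inf; [exists 0 => _ [z _ <-]|exists y].
Qed.

Lemma le_dist_out Omega x y c : ~ Omega y ->
  (forall z, ~ Omega z -> c <= `|x - z|) -> c <= dist_out Omega x.
Proof.
move=> Oy h; apply: lb_le_inf; first by exists `|x - y|, y.
by move=> _ [z Oz <-]; exact: h.
Qed.

Lemma dist_out_lipschitz Omega x y z : ~ Omega z ->
  `|dist_out Omega x - dist_out Omega y| <= `|x - y|.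
Proof.
move=> Oz; have H u v : dist_out Omega u - `|u - v| <= dist_out Omega v.
  apply: (le_dist_out Oz) => w Ow; rewrite lerBlDr.
  apply: (le_trans (dist_out_le u Ow)).
  by rewrite [leRHS]addrC; exact: ler_distD.
have := H x y; have := H y x; rewrite (distrC y x) ler_norml => ? ?.
by apply/andP; split; lra.
Qed.

Lemma dist_out_gt0 Omega x z : ~ Omega z -> open Omega -> Omega x -> 0 < dist_out Omega x.
Proof.
move=> Oz oO Ox; have /nbhs_ballP[e /= e0 eO] := oO _ Ox.
apply: (lt_le_trans e0); apply: (le_dist_out Oz) => y Oy.
by rewrite leNgt; apply/negP => xy; apply: Oy; exact: eO.
Qed.

Lemma dist_out_le0 Omega x : ~ Omega x -> dist_out Omega x <= 0.
Proof. by move=> Ox; have := dist_out_le x Ox; rewrite subrr normr0. Qed.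

Lemma continuous_dist_out Omega z : ~ Omega z -> continuous (dist_out Omega).
Proof.
move=> Oz x; apply/cvgrPdist_le => e e0; near=> y.
apply: (le_trans (dist_out_lipschitz x y Oz)).
near: y; have /cvgrPdist_le := @cvg_id _ (nbhs x); exact.
Unshelve. all: by end_near. Qed.

Definition clamp (k t : R) := Num.max (- k) (Num.min k t).

Lemma clamp_dist (E k1 k2 t1 t2 : R) : 0 <= k1 -> 0 <= k2 -> `|k1 - k2| <= E ->
  `|t1 - t2| <= E -> `|clamp k1 t1 - clamp k2 t2| <= E.
Proof.
rewrite /clamp !ler_norml => k10 k20 /andP[? ?] /andP[? ?].
by rewrite /Num.max /Num.min; case: (ltP k1 t1) => ?; case: (ltP k2 t2) => ?;
  do ?[case: (ltP (- k1) _) => ?]; do ?[case: (ltP (- k2) _) => ?]; apply/andP; split; lra.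
Qed.

Lemma clamp_id (k t : R) : `|t| <= k -> clamp k t = t.
Proof. by rewrite ler_norml => /andP[h1 h2]; rewrite /clamp min_r// max_r. Qed.

Lemma clamp0 (t : R) : clamp 0 t = 0.
Proof.
by rewrite /clamp /Num.max /Num.min oppr0; case: (ltP 0 t) => ?; case: ltP => // ?; lra.
Qed.

End distance.

(** * Approximation by test functions *)

Section approximation.
Context {R : realType}.
Notation mu := (@lebesgue_measure R).
Implicit Types (Omega : set R) (g w G W : R -> R) (a b c C d r x y z K : R).

(** By parts, the derivative moves from the mollifier to [W]; the mollifier
    vanishes at [a] and [b] since [x] is farther than [r] from them. *)
Lemma mollify_derive a b C W G r x : a < b -> 0 < r -> a < x - r -> x + r < b ->
  lipschitz_itv C a b W -> measurable_fun `[a, b] G ->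
  {ae mu, forall x, a < x < b -> is_derive x 1 W (G x)} ->
  mollify a b W (mollifier r)^`()%classic x = mollify a b G (mollifier r) x.
Proof.
move=> ab r0 ax xb lW mG dW; have ck := smooth_cpt_mollifier r0.
pose V y := mollifier r (x - y); pose V' y := - (mollifier r)^`()%classic (x - y).
have dV y : is_derive y 1 V (V' y).
  have [sB' _] := ck; have dBz := smoothn_is_derive (sB' 1%N) (x - y).
  have dz : is_derive y 1 (fun z : R => x - z) (- 1).
    have := is_deriveB (is_derive_cst x y 1) (is_derive_id y 1).
    by move/is_derive_eq; apply; rewrite sub0r.
  have := @is_derive1_comp _ (mollifier r) (fun z => x - z) _ _ _ dBz dz.
  by move/is_derive_eq; apply; rewrite mulrN1.
have V'E : V^`()%classic = V'.
  by apply/funext => y; rewrite derive1E; case: (dV y).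
have cV' : continuous V'.
  move=> y; apply: cvgN.
  apply: (@continuous_comp _ _ _ (fun y : R => x - y) (mollifier r)^`()%classic).
    by apply: cvgB; [exact: cvg_cst|exact: cvg_id].
  by apply: smooth_cpt_continuous; exact: smooth_cpt_derive.
have [K lV] : exists K, lipschitz_itv K a b V.
  apply: C1_lipschitz_itv => //.
  by rewrite V'E.
have mV' : measurable_fun `[a, b] V'.
  by apply: measurable_funTS; exact: continuous_measurable_fun.
have Va : V a = 0 by rewrite /V mollifier_out// ger0_norm; lra.
have Vb : V b = 0 by rewrite /V mollifier_out// ler0_norm; lra.
have dVae : {ae mu, forall y, a < y < b -> is_derive y 1 V (V' y)} by exact: aeW.
have E := lipschitz_ibp ab lW lV mG mV' dW dVae Va Vb.
have iW := integrable_mollify x (lipschitz_itv_measurable ab lW)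
  (lipschitz_itv_bounded ab lW) (smooth_cpt_derive ck).
apply: oppr_inj; rewrite /mollify -E -mulN1r -RintegralZl//.
by apply: eq_Rintegral => y _; rewrite mulN1r mulrN.
Qed.

(** With [D] the distance to the complement of [Omega], [w] is first truncated
    to the band of half-width [2 * C * (D - d)^+], then mollified at the scale
    [d / 2]. The truncation vanishes where [D <= d], so the mollification has
    compact support in [Omega]. As [`|w| <= C * D], the band contains the graph
    of [w] where [D >= 2 * d], and there the truncation does nothing; as its
    width has slope [2 * C], the truncated function is [2 * C]-Lipschitz for
    every [d]. *)
Lemma approx_step Omega a b C w g d : open Omega -> a < b -> 0 < C ->
  (forall x, Omega x -> a + 1 < x < b - 1) ->
  lipschitz_itv C a b w -> (forall x, ~ Omega x -> w x = 0) ->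
  measurable_fun `[a, b] g ->
  {ae mu, forall x, a < x < b -> is_derive x 1 w (g x)} ->
  0 < d -> d <= 1 ->
  exists phi, [/\ test_function Omega phi,
    forall x, Omega x -> `|phi^`()%classic x| <= 2 * C &
    forall x, Omega x -> 3 * d <= dist_out Omega x ->
      `|phi^`()%classic x - g x| <=
      expR 4 / (d / 2) * \int[mu]_(y in ball x (d / 2)) `|g y - g x|].
Proof.
move=> oO ab C0 Oab lw w0 mg dg d0 d1.
have Oa : ~ Omega a by move=> /Oab; lra.
have Ob : ~ Omega b by move=> /Oab; lra.
set r := d / 2; have r0 : 0 < r by rewrite /r; lra.
pose k x := 2 * C * Num.max 0 (dist_out Omega x - d).
have k0 x : 0 <= k x by rewrite /k mulr_ge0 ?le_max ?lexx//; lra.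
pose wd x := clamp (k x) (w x).
have lk x y : `|k x - k y| <= 2 * C * `|x - y|.
  rewrite /k -mulrBr normrM ger0_norm; last by lra.
  apply: ler_wpM2l; first by lra.
  have := dist_out_lipschitz x y Oa; rewrite !ler_norml => /andP[h1 h2].
  by rewrite /Num.max; case: ltP => ?; case: ltP => ?; apply/andP; split; lra.
have lwd : lipschitz_itv (2 * C) a b wd.
  move=> x y ax xy yb; apply: clamp_dist => //.
    by have := lk y x; rewrite (@ger0_norm _ (y - x)) ?subr_ge0.
  apply: (le_trans (lw _ _ ax xy yb)); apply: ler_wpM2r; lra.
have wdE x : Omega x -> 2 * d <= dist_out Omega x -> wd x = w x.
  move=> Ox dx; apply: clamp_id.
  rewrite /k max_r; last by lra.
  have /andP[xa xb] := Oab _ Ox.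
  have wz z : ~ Omega z -> a <= z <= b -> `|w x| <= C * `|x - z|.
    move=> Oz /andP[az zb]; have [xz|zx] := leP x z.
      have -> : `|x - z| = z - x by rewrite distrC ger0_norm// subr_ge0.
      by rewrite -normrN -(sub0r (w x)) -(w0 _ Oz); apply: lw => //; lra.
    have -> : `|x - z| = x - z by rewrite ger0_norm// subr_ge0 ltW.
    by rewrite -(subr0 (w x)) -(w0 _ Oz); apply: lw => //; lra.
  have : `|w x| / C <= dist_out Omega x.
    apply: (le_dist_out Oa) => z Oz; rewrite ler_pdivrMr// mulrC.
    have [za|az] := ltP z a.
      apply: (le_trans (wz a Oa _)); first by rewrite lexx ltW.
      by rewrite ler_pM2l// !ger0_norm; lra.
    have [bz|zb] := ltP b z.
      apply: (le_trans (wz b Ob _)); first by rewrite lexx ltW.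
      by rewrite ler_pM2l// !ler0_norm; lra.
    by apply: wz => //; rewrite az.
  rewrite ler_pdivrMr// => h; apply: (le_trans h).
  have : 0 <= C * (dist_out Omega x - 2 * d) by apply: mulr_ge0; lra.
  by lra.
have wd0 x : dist_out Omega x <= d -> wd x = 0.
  by move=> dx; rewrite /wd /k max_l ?mulr0; [exact: clamp0|lra].
have [gd [mgd gdC dgd]] := lipschitz_density ab lwd.
have mgd' : measurable_fun `[a, b] gd by exact: measurable_funTS.
have mwd := lipschitz_itv_measurable ab lwd.
have bwd := lipschitz_itv_bounded ab lwd.
have ck := smooth_cpt_mollifier r0.
have m0 := mollifier_mass_gt0 r0.
pose phi x := (mollifier_mass r)^-1 * mollify a b wd (mollifier r) x.
have phi' x : a < x - r -> x + r < b -> phi^`()%classic x =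
    (mollifier_mass r)^-1 * mollify a b gd (mollifier r) x.
  move=> ax xb; rewrite derive1E -(mollify_derive ab r0 ax xb lwd mgd' dgd).
  have := is_deriveZ (mollifier_mass r)^-1 (is_derive_mollify x mwd bwd ck).
  by case.
have phi0 x : dist_out Omega x < r -> phi x = 0.
  move=> dx; rewrite /phi /mollify; under eq_Rintegral.
    move=> y _; rewrite (_ : _ * _ = 0); last first.
      have [dy|dy] := leP (dist_out Omega y) d; first by rewrite wd0// mul0r.
      rewrite mollifier_out ?mulr0//.
      have := dist_out_lipschitz x y Oa; rewrite ler_norml => /andP[? ?].
      by rewrite /r in dx *; lra.
    over.
  by rewrite Rintegral_cst// mul0r mulr0.
have Or x : Omega x -> a < x - r /\ x + r < b.
  by move=> /Oab/andP[? ?]; rewrite /r; split; lra.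
exists phi; split.
- apply: (@test_functionP _ (`[a, b] `&` [set x | r <= dist_out Omega x])).
  + move=> n; apply: smoothnM; first exact: smoothn_cst.
    exact: smoothn_mollify bwd ck.
  + apply: (@subclosed_compact _ _ `[a, b]); [|exact: segment_compact|by move=> x []].
    apply: closedI; first exact: itv_closed.
    have /continuous_closedP := continuous_dist_out Oa.
    by move=> /(_ [set y | r <= y] (@closed_ge _ r)).
  + move=> x [_ /= rx]; apply: contrapT => Ox; have := dist_out_le0 Ox; lra.
  + move=> x /= xS; have [xr|xr] := ltP (dist_out Omega x) r; first exact: phi0.
    exfalso; apply: xS; split => //.
    have Ox : Omega x by apply: contrapT => Ox; have := dist_out_le0 Ox; lra.
    by have /andP[? ?] := Oab _ Ox; rewrite /= in_itv/=; apply/andP; split; lra.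
- move=> x /Or[ax xb]; rewrite phi'//.
  rewrite normrM gtr0_norm ?invr_gt0// mulrC ler_pdivrMr//.
  by apply: mollifier_average_le => //; exact: ltW.
- move=> x Ox dx; have [ax xb] := Or _ Ox; rewrite phi'//.
  have := @mollifier_average_near _ r a b x gd (2 * C) (g x) r0 (ltW ax) (ltW xb)
    mgd' (fun y _ => gdC y).
  move=> /le_trans; apply; rewrite le_eqVlt; apply/orP; left; apply/eqP.
  have mball G : measurable_fun `[a, b] G ->
      measurable_fun (ball x r) (fun y => `|G y - g x|%:E).
    move=> mG; apply/measurable_EFinP; apply: measurableT_comp => //.
    apply: measurable_funB => //; apply: measurable_funS mG => //.
    by move=> y; rewrite ball_itv /= !in_itv/= => /andP[h1 h2]; apply/andP; split; lra.
  (* The ball of radius [d / 2] around [x] stays in the region where the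
     truncation is inactive, and there [g] and [gd] are derivatives of the same
     function. *)
  congr (_ * _); congr fine.
  apply: ae_eq_integral; [exact: measurable_ball|exact: mball|exact: mball|].
  have aeF := ae_filter_ringOfSetsType mu.
  apply: (@filterS2 _ _ aeF _ _ _ _ dg dgd) => y gy gdy xy.
  suff -> : gd y = g y by [].
  have yab : a < y < b.
    by move: xy; rewrite ball_itv /= in_itv/= => /andP[? ?]; apply/andP; split; lra.
  have dy : 2 * d < dist_out Omega y.
    have := dist_out_lipschitz x y Oa; rewrite ler_norml => /andP[? ?].
    by move: xy; rewrite /ball/= /r => ?; lra.
  apply: is_derive_unique (gdy yab) _.
  apply: (@near_eq_is_derive _ R R w); last exact: gy.
  have cd : \forall z \near y, 2 * d < dist_out Omega z.
    have cc : dist_out Omega z @[z --> y] --> dist_out Omega y by exact: continuous_dist_out Oa _.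
    by move/cvgr_gt: cc; apply.
  near=> z; have dz : 2 * d < dist_out Omega z by near: z.
  rewrite wdE//; last exact: ltW.
  by apply: contrapT => Oz; have := dist_out_le0 Oz; lra.
Unshelve. all: by end_near. Qed.

End approximation.

Section density.
Context {R : realType}.
Notation mu := (@lebesgue_measure R).
Implicit Types (Omega : set R) (g w phi : R -> R) (a b C r x y e K : R).

Lemma bounded_locally_integrable g C : measurable_fun setT g ->
  (forall x, `|g x| <= C) -> locally_integrable setT g.
Proof.
move=> mg gC; split => //; first exact: openT.
move=> A _ cA; have : mu.-integrable A (EFin \o g).
  apply: (@bounded_integrable _ _ _ C) => //.
  - exact: compact_measurable.
  - exact: compact_finite_measure.
  - exact: measurable_funTS.
by case/integrableP.
Qed.

Lemma fine_davg g C x r : measurable_fun setT g -> (forall y, `|g y| <= C) -> 0 < r ->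
  davg g x r = ((r *+ 2)^-1 * \int[mu]_(y in ball x r) `|g y - g x|)%:E.
Proof.
move=> mg gC r0; rewrite /davg /iavg lebesgue_measure_ball ?ltW//.
have r20 : r *+ 2 != 0 by rewrite mulrn_eq0/= gt_eqF.
rewrite inver (negbTE r20) EFinM; congr (_ * _)%E.
rewrite /Rintegral fineK//; apply: integrable_fin_num; first exact: measurable_ball.
apply: (@bounded_integrable _ _ _ (2 * C)).
- exact: measurable_ball.
- by rewrite lebesgue_measure_ball ?ltW// ltry.
- apply: measurableT_comp => //; apply: measurable_funB => //; exact: measurable_funTS.
- move=> y _; rewrite normr_id (le_trans (ler_normB _ _))//.
  by rewrite mulr_natl mulr2n lerD.
Qed.

(** At a Lebesgue point of [g] in [Omega] the derivatives of the approximations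
    converge to [g], since the distance to the complement eventually exceeds
    [3 * d]; they are bounded by [2 * C], so the convergence holds in mean. *)
Lemma approx_derivative Omega a b C w g e : open Omega -> a < b -> 0 < C ->
  (forall x, Omega x -> a + 1 < x < b - 1) ->
  lipschitz_itv C a b w -> (forall x, ~ Omega x -> w x = 0) ->
  measurable_fun setT g -> (forall x, `|g x| <= C) ->
  {ae mu, forall x, a < x < b -> is_derive x 1 w (g x)} -> 0 < e ->
  exists2 phi, test_function Omega phi &
    (\int[mu]_(x in Omega) `|g x - (phi^`())%classic x|%:E < e%:E)%E.
Proof.
move=> oO ab C0 Oab lw w0 mg gC dg e0.
have mO := open_measurable oO.
have mgab : measurable_fun `[a, b] g by exact: measurable_funTS.
have Oa : ~ Omega a by move=> /Oab; lra.
have aeF := ae_filter_ringOfSetsType mu.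
have d0 n : 0 < @harmonic R n by rewrite /harmonic/= invr_gt0.
have d1 n : @harmonic R n <= 1 by rewrite /harmonic/= invf_le1// ler1n.
have step n := approx_step oO ab C0 Oab lw w0 mgab dg (d0 n) (d1 n).
have [phi phiP] := choice step.
have Oitv : Omega `<=` `[a, b].
  by move=> x /Oab xab; rewrite /= in_itv/=; lra.
have Ooo : (mu Omega < +oo)%E.
  apply: le_lt_trans (itv_measure_lty a b); apply: le_measure => //; rewrite inE//.
pose f_ (n : nat) (x : R) : \bar R := `|g x - (phi n)^`()%classic x|%:E.
have mf_ n : measurable_fun Omega (f_ n).
  apply/measurable_EFinP; apply: measurableT_comp => //.
  apply: measurable_funB; first exact: measurable_funTS.
  by have [tphi _ _] := phiP n; exact: test_function_derive_measurable tphi.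
pose G : R -> R := cst (3 * C).
have iG : mu.-integrable Omega (EFin \o G).
  apply: (@bounded_integrable _ _ _ (3 * C)) => //; first exact: measurable_cst.
  by move=> x _; rewrite /G /= ger0_norm//; lra.
have fG : {ae mu, forall x n, Omega x -> (`|f_ n x| <= (EFin \o G) x)%E}.
  apply: aeW => x n Ox; rewrite /f_ /= lee_fin normr_id.
  have [_ /(_ _ Ox) pC _] := phiP n.
  by apply: (le_trans (ler_normB _ _)); rewrite /G /=; have := gC x; lra.
have fc : {ae mu, forall x, Omega x -> f_ n x @[n --> \oo] --> (cst 0%E : R -> \bar R) x}.
  have := lebesgue_differentiation (bounded_locally_integrable mg gC).
  apply: (@filterS _ _ aeF) => x gx Ox.
  rewrite /f_ /=; apply: cvg_EFin; first exact: nearW.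
  have D0 := dist_out_gt0 Oa oO Ox.
  have /fine_cvgP[_ /cvg_at_rightP gx'] : davg g x r @[r --> 0^'+] --> 0%:E by exact: gx.
  have := gx' (fun n => harmonic n / 2).
  have h2 : @harmonic R n / 2 @[n --> \oo] --> 0.
    by rewrite -(mul0r 2^-1); apply: cvgMl; exact: cvg_harmonic.
  have hs n : 0 < @harmonic R n / 2 by rewrite divr_gt0.
  move=> /(_ (conj hs h2)) H.
  have h3 : \forall n \near \oo, 3 * @harmonic R n <= dist_out Omega x.
    have /cvgr_le : 3 * @harmonic R n @[n --> \oo] --> 0.
      by rewrite -(mulr0 3); apply: cvgMr; exact: cvg_harmonic.
    by apply.
  have {}H : 2 * expR 4 * fine (davg g x (harmonic n / 2)) @[n --> \oo] --> 0.
    by rewrite -(mulr0 (2 * expR 4)); apply: cvgMr.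
  apply: (@squeeze_cvgr _ _ _ _ (cst 0) _ _ _ _ _ H); last exact: cvg_cst.
  near=> n; rewrite normr_ge0 /= distrC.
  have [_ _ /(_ _ Ox)] := phiP n.
  move=> H3; have dx : 3 * @harmonic R n <= dist_out Omega x by near: n.
  apply: (le_trans (H3 dx)).
  rewrite (fine_davg x mg gC) ?divr_gt0//=.
  set I := Rintegral _ _ _; have r0 := d0 n.
  rewrite le_eqVlt; apply/orP; left; apply/eqP; rewrite -mulr_natl.
  by field; rewrite gt_eqF.
have [_ _] := @dominated_convergence _ _ _ mu Omega mO f_ (cst 0%E) (EFin \o G)
  mf_ (measurable_cst _) fc iG fG.
rewrite integral0 => H.
have : \forall n \near \oo, (\int[mu]_(x in Omega) f_ n x < e%:E)%E.
  exact: (H _ (nbhs_open_ereal_lt (f := fun _ => e) e0)).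
move=> [N _ /(_ N (leqnn _))] HN; exists (phi N) => //.
by have [] := phiP N.
Unshelve. all: by end_near. Qed.

End density.

(** * Lipschitz functions vanishing outside the open set *)

Section vanishing_traces.
Context {R : realType}.
Notation mu := (@lebesgue_measure R).
Implicit Types (Omega : set R) (g h u v w phi : R -> R) (a b C r x y e K : R).

Lemma ae_integrable Omega g h : measurable Omega -> mu.-integrable Omega (EFin \o g) ->
  measurable_fun Omega h -> {ae mu, forall x, Omega x -> h x = g x} ->
  mu.-integrable Omega (EFin \o h).
Proof.
move=> mO ig mh hg; have aeF := ae_filter_ringOfSetsType mu.
have /integrableP[mg goo] := ig.
have mh' : measurable_fun Omega (EFin \o h) by exact/measurable_EFinP.
apply/integrableP; split => //; apply: le_lt_trans goo.
rewrite le_eqVlt; apply/orP; left; apply/eqP.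
apply: ae_eq_integral => //; [exact: measurableT_comp|exact: measurableT_comp|].
by apply: (@filterS _ _ aeF _ _ _ hg) => x E /E /= ->.
Qed.

Lemma bounded_Loo Omega g K : measurable_fun Omega g ->
  {ae mu, forall x, Omega x -> `|g x| <= K} -> Loo Omega g.
Proof.
move=> mg gK; split => //; apply: (@le_lt_trans _ _ K%:E); last exact: ltry.
apply/ess_sup_onP; have aeF := ae_filter_ringOfSetsType mu.
by apply: (@filterS _ _ aeF _ _ _ gK) => x E /E; rewrite lee_fin.
Qed.

Lemma test_function_weak_derivative Omega a b phi : open Omega -> a < b ->
  (forall x, Omega x -> a < x < b) -> test_function Omega phi ->
  is_weak_derivative Omega phi (phi^`())%classic.
Proof.
move=> oO ab Oab tphi; have [K lphi] := test_function_lipschitz ab tphi.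
apply: (lipschitz_weak_derivative ab oO Oab lphi).
- exact: test_function_derive_measurable tphi.
- by apply: aeW => x _; exact: test_function_is_derive tphi.
Qed.

(** The norm is stated with the chosen representative of the weak derivative;
    any other one computes it as well. *)
Lemma W11_normE Omega u v : open Omega -> is_weak_derivative Omega u v ->
  W11_norm Omega u = (\int[mu]_(x in Omega) `|u x|%:E + \int[mu]_(x in Omega) `|v x|%:E)%E.
Proof.
move=> oO uv; rewrite /W11_norm; congr (_ + _)%E.
have [[_ [mw _ _] _] wv] := weak_derivativeP uv; have [_ [mv _ _] _] := uv.
have aeF := ae_filter_ringOfSetsType mu.
apply: ae_eq_integral.
- exact: open_measurable.
- by apply/measurable_EFinP; exact: measurableT_comp.
- by apply/measurable_EFinP; exact: measurableT_comp.
- by apply: (@filterS _ _ aeF _ _ _ wv) => x E /E ->.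
Qed.

(** Poincare's inequality: [w] vanishes at the left end of the component of
    [x], and [g] integrates to its increment from there to [x]. *)
Lemma sup_le_integral Omega a b K w g x : open Omega -> a < b ->
  (forall y, Omega y -> a < y < b) ->
  lipschitz_itv K a b w -> (forall x, ~ Omega x -> w x = 0) ->
  measurable_fun `[a, b] g -> {ae mu, forall x, a < x < b -> is_derive x 1 w (g x)} ->
  Omega x -> `|w x| <= \int[mu]_(y in Omega) `|g y|.
Proof.
move=> oO ab Oab lw w0 mg dg Ox; have mO := open_measurable oO.
have Oa : ~ Omega a by move=> /Oab; rewrite ltxx.
have /andP[ax xb] := Oab _ Ox.
have [lx Ol lO] := lftP oO (ltW ax) Oa.
have al : a <= lft Omega x.
  by rewrite leNgt; apply/negP => la; apply: Oa; apply: lO => //; exact: ltW.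
have [ig gE] := lipschitz_FTC ab lw mg dg.
have := gE _ _ al lx (ltW xb); rewrite (w0 _ Ol) subr0 => <-.
have Oitv : Omega `<=` `[a, b].
  by move=> y /Oab /andP[ay yb]; rewrite /= in_itv/= !ltW.
have ig' : mu.-integrable `[lft Omega x, x] (EFin \o g).
  apply: (@integrableS _ _ _ mu `[a, b]) => //.
  by apply: subset_itv; rewrite bnd_simp// ltW.
have iga : mu.-integrable Omega (EFin \o (fun y => `|g y|)).
  have : mu.-integrable Omega (EFin \o g) by exact: (@integrableS _ _ _ mu `[a, b]).
  exact: integrable_abse.
apply: (le_trans (le_normr_Rintegral _ ig')) => //.
rewrite -Rintegral_itv_obnd_cbnd; last first.
  apply: (@integrableS _ _ _ mu `[lft Omega x, x]) => //; first exact: subset_itv_oc_cc.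
  exact: integrable_abse ig'.
by apply: ge0_subset_Rintegral => // y /=; rewrite in_itv/= => /andP[? ?]; exact: lO.
Qed.

(** Approximating the derivative of [w] in mean is enough: by Poincare's
    inequality the approximations are then uniformly close to [w], and [Omega]
    has finite measure. *)
Lemma lipschitz_W1oo0 Omega a b C w g : open Omega -> a < b -> 0 < C ->
  (forall x, Omega x -> a + 1 < x < b - 1) ->
  lipschitz_itv C a b w -> (forall x, ~ Omega x -> w x = 0) ->
  measurable_fun setT g -> (forall x, `|g x| <= C) ->
  {ae mu, forall x, a < x < b -> is_derive x 1 w (g x)} ->
  W1oo0 Omega w.
Proof.
move=> oO ab C0 Oab lw w0 mg gC dg.
have mO := open_measurable oO.
have aeF := ae_filter_ringOfSetsType mu.
have Oab' x : Omega x -> a < x < b by move=> /Oab /andP[? ?]; apply/andP; split; lra.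
have Oitv : Omega `<=` `[a, b].
  by move=> y /Oab' /andP[ay yb]; rewrite /= in_itv/= !ltW.
have mgab : measurable_fun `[a, b] g by exact: measurable_funTS.
have wg := lipschitz_weak_derivative ab oO Oab' lw mgab dg.
have [ww' w'g] := weak_derivativeP wg.
have [_ [mw' _ _] _] := ww'.
have mw : measurable_fun Omega w.
  by apply: measurable_funS (lipschitz_itv_measurable ab lw).
have Ooo : (mu Omega < +oo)%E.
  by apply: le_lt_trans (itv_measure_lty a b); apply: le_measure => //; rewrite inE.
have wd : weakly_derivable Omega w by exists g.
split; [split; [split => //|]|split => //].
- apply: (@bounded_integrable _ _ _ (`|w a| + C * (b - a))) => // x Ox.
  by apply: (lipschitz_itv_bounded ab lw); exact: Oitv.
- apply: ae_integrable w'g => //.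
  by apply: (@bounded_integrable _ _ _ C) => //; exact: measurable_funTS.
- move=> e e0.
  (* If the derivatives differ by less than [e'] in mean, then the W11 distance
     is at most [e' * (b - a) + e'], whence the choice of [e']. *)
  have e1 : 0 < e / (b - a + 1) by rewrite divr_gt0//; lra.
  have [phi tphi phie] := approx_derivative oO ab C0 Oab lw w0 mg gC dg e1.
  exists phi => //.
  have phid := test_function_weak_derivative oO ab Oab' tphi.
  rewrite (W11_normE oO (is_weak_derivativeB wg phid)).
  set I := (\int[mu]_(x in Omega) `|(g \- _) x|%:E)%E.
  have If : I \is a fin_num.
    by rewrite ge0_fin_numE ?(lt_trans phie) ?ltry// integral_ge0.
  have I1 : fine I < e / (b - a + 1) by rewrite -lte_fin fineK.
  have I0 : 0 <= fine I by rewrite fine_ge0// integral_ge0.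
  have sup x : Omega x -> `|(w \- phi) x| <= fine I.
    have [K lphi] := test_function_lipschitz ab tphi.
    apply: (@sup_le_integral Omega a b (C + K)) => //.
    + move=> y z ay yz zb /=.
      have -> : w z - phi z - (w y - phi y) = (w z - w y) - (phi z - phi y) by ring.
      rewrite (le_trans (ler_normB _ _))// mulrDl; apply: lerD; [exact: lw|exact: lphi].
    + by move=> y Oy /=; rewrite w0// (test_function_out tphi)// subr0.
    + by apply: measurable_funB => //; exact: test_function_derive_measurable tphi.
    + apply: (@filterS _ _ aeF _ _ _ dg) => y gy yab; have dw := gy yab.
      have dphi := test_function_is_derive y tphi.
      exact: is_deriveB.
  apply: (@le_lt_trans _ _ ((fine I)%:E * (b - a)%:E + (fine I)%:E)%E).
    apply: leeD; last by rewrite fineK.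
    apply: (@le_trans _ _ (\int[mu]_(x in Omega) (cst (fine I)%:E x))%E).
      apply: ge0_le_integral => //.
        apply/measurable_EFinP; apply: measurableT_comp => //; apply: measurable_funB => //.
        apply: measurable_funTS; apply: continuous_measurable_fun.
        exact: test_function_continuous tphi.
    rewrite integral_cst//; apply: lee_wpmul2l; first by rewrite lee_fin.
    apply: (@le_trans _ _ (mu `[a, b])); first by apply: le_measure => //; rewrite inE.
    by rewrite lebesgue_measure_itv/= lte_fin ab.
  rewrite -EFinM -EFinD lte_fin.
  by move: I1; rewrite ltr_pdivlMr; lra.
- apply: (bounded_Loo (K := `|w a| + C * (b - a))) => //; apply: aeW => x Ox.
  by apply: (lipschitz_itv_bounded ab lw); exact: Oitv.
- apply: (bounded_Loo (K := C)) => //.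
  by apply: (@filterS _ _ aeF _ _ _ w'g) => x E /E ->.
Qed.

End vanishing_traces.

(** * Lipschitz extension *)

Section extension.
Context {R : realType}.
Implicit Types (f F : R -> R) (A : set R) (L x y z : R).

Lemma lipschitz_onP f A : [lipschitz f x | x in A] ->
  exists2 L, 0 < L & forall x y, A x -> A y -> `|f x - f y| <= L * `|x - y|.
Proof.
move=> [M [Mr lM]]; exists (`|M| + 1); first by rewrite ltr_wpDl.
move=> x y Ax Ay; apply: (lM (`|M| + 1) _ (x, y)) => //.
by rewrite (le_lt_trans (ler_norm M))// ltrDl.
Qed.

(** McShane's extension: the lower envelope of the cones of slope [L] with their
    tips on the graph of [f]. *)
Lemma lipschitz_extend f A L : A !=set0 -> 0 <= L ->
  (forall x y, A x -> A y -> `|f x - f y| <= L * `|x - y|) ->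
  exists F, (forall x, A x -> F x = f x) /\ (forall x y, `|F x - F y| <= L * `|x - y|).
Proof.
move=> [y0 Ay0] L0 fl; pose S x := [set f y + L * `|x - y| | y in A].
have Slb x : has_lbound (S x).
  exists (f y0 - L * `|x - y0|) => _ [y Ay <-].
  have := fl y0 y Ay0 Ay; rewrite ler_norml => /andP[_ h1].
  have : L * `|y0 - y| <= L * (`|x - y0| + `|x - y|).
    by apply: ler_wpM2l => //; rewrite [`|x - y0|]distrC; exact: ler_distD.
  by rewrite mulrDr; lra.
have S0 x : S x !=set0 by exists (f y0 + L * `|x - y0|), y0.
have FH x z : inf (S x) <= inf (S z) + L * `|x - z|.
  rewrite -lerBlDr; apply: lb_le_inf => // _ [y Ay <-]; rewrite lerBlDr.
  apply: (@le_trans _ _ (f y + L * `|x - y|)); first by apply: ge_inf => //; exists y.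
  rewrite -addrA lerD2l -mulrDr; apply: ler_wpM2l => //.
  by rewrite [leRHS]addrC; exact: ler_distD.
exists (fun x => inf (S x)); split=> [x Ax|x y].
  apply/eqP; rewrite eq_le; apply/andP; split.
    by apply: ge_inf => //; exists x => //; rewrite subrr normr0 mulr0 addr0.
  apply: lb_le_inf => // _ [y Ay <-].
  by have := fl x y Ax Ay; rewrite ler_norml => /andP[_ ?]; lra.
rewrite ler_norml; have h1 := FH x y; have h2 := FH y x; rewrite (distrC y x) in h2.
by apply/andP; split; lra.
Qed.

End extension.

(** * Tents with two prescribed slopes *)

Section tent.
Context {R : realType}.
Implicit Types (Omega : set R) (U f w : R -> R) (a b l r p q x y z L D s : R).

Definition component Omega l r :=
  [/\ l < r, ~ Omega l, ~ Omega r & forall z, l < z < r -> Omega z].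

Lemma component_in Omega a b x : open Omega -> ~ Omega a -> ~ Omega b ->
  a <= x -> x <= b -> Omega x ->
  exists l r, [/\ component Omega l r, l < x < r, a <= l & r <= b].
Proof.
move=> oO Oa Ob ax xb Ox.
have [h1 h2 h3] := lftP oO ax Oa; have [k1 k2 k3] := rgtP oO xb Ob.
have lx : lft Omega x < x.
  by rewrite lt_neqAle h1 andbT; apply/eqP => e; apply: h2; rewrite e.
have xr : x < rgt Omega x.
  by rewrite lt_neqAle k1 andbT; apply/eqP => e; apply: k2; rewrite -e.
exists (lft Omega x), (rgt Omega x); split.
- split=> //; first exact: lt_trans xr.
  move=> z /andP[lz zr]; have [zx|xz] := leP z x; first exact: h3.
  by apply: k3 => //; exact: ltW.
- by rewrite lx.
- by rewrite leNgt; apply/negP => la; apply: Oa; exact: h3.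
- by rewrite leNgt; apply/negP => la; apply: Ob; exact: k3.
Qed.

(** On a component it rises with slope [q] from the left boundary value, then
    follows the line of slope [p] that ends at the right boundary value. *)
Definition tent p q Omega U x :=
  Num.min (U (lft Omega x) + q * (x - lft Omega x))
          (U (rgt Omega x) - p * (rgt Omega x - x)).

Lemma tent_out p q Omega U x : open Omega -> ~ Omega x -> tent p q Omega U x = U x.
Proof.
move=> oO Ox; rewrite /tent (@lft_eq _ _ x)//; last by move=> y xy yx; lra.
rewrite (@rgt_eq _ _ x)//; last by move=> y xy yx; lra.
by rewrite subrr !mulr0 addr0 subr0 minxx.
Qed.

(** The chord slope lies between [p] and [q], so at each end of the component the
    minimum is attained by the branch that starts from that end. *)
Lemma tent_component p q Omega U l r y : open Omega -> component Omega l r ->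
  p * (r - l) <= U r - U l <= q * (r - l) -> l <= y -> y <= r ->
  tent p q Omega U y = Num.min (U l + q * (y - l)) (U r - p * (r - y)).
Proof.
move=> oO [lr Ol Or lrO] /andP[pU Uq].
rewrite le_eqVlt => /predU1P[<- _|ly].
  by rewrite tent_out// subrr mulr0 addr0 min_l//; lra.
rewrite le_eqVlt => /predU1P[->|yr].
  by rewrite tent_out// subrr mulr0 subr0 min_r//; lra.
rewrite /tent (@lft_eq _ _ l)//; [|exact: ltW|]; last first.
  by move=> z lz zy; apply: lrO; rewrite lz (le_lt_trans zy).
rewrite (@rgt_eq _ _ r)//; first exact: ltW.
by move=> z yz zr; apply: lrO; rewrite zr (lt_le_trans ly).
Qed.

Lemma min_dist (E s1 s2 t1 t2 : R) : `|s1 - s2| <= E -> `|t1 - t2| <= E ->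
  `|Num.min s1 t1 - Num.min s2 t2| <= E.
Proof.
rewrite !ler_norml => /andP[? ?] /andP[? ?].
by rewrite /Num.min; case: (ltP s1 t1) => ?; case: (ltP s2 t2) => ?; apply/andP; split; lra.
Qed.

Lemma tent_lipschitz p q Omega U L a b : open Omega -> ~ Omega a -> ~ Omega b ->
  0 <= L -> lipschitz_itv L a b U -> (forall x, Omega x -> a < x < b) ->
  (forall l r, component Omega l r -> p * (r - l) <= U r - U l <= q * (r - l)) ->
  lipschitz_itv (`|p| + `|q| + L) a b (tent p q Omega U \- U).
Proof.
move=> oO Oa Ob L0 lU Oab pq.
apply: (@lipschitz_glue _ Omega) => //; first by rewrite !addr_ge0.
  by move=> x Ox /=; rewrite tent_out// subrr.
move=> x y xy xyO.
have Oc : Omega ((x + y) / 2) by apply: xyO; apply/andP; split; lra.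
have /andP[ac cb] := Oab _ Oc.
have [l [r [clr /andP[lc cr] al rb]]] := component_in oO Oa Ob (ltW ac) (ltW cb) Oc.
have [lr Ol Or lrO] := clr.
have lx : l <= x.
  by rewrite leNgt; apply/negP => xl; apply: Ol; apply: xyO; apply/andP; split; lra.
have yr : y <= r.
  by rewrite leNgt; apply/negP => ry; apply: Or; apply: xyO; apply/andP; split; lra.
have pqlr := pq _ _ clr.
rewrite /= !(tent_component oO clr pqlr); [|lra..].
rewrite mulrDl; set m1 := Num.min _ _; set m2 := Num.min _ _.
have -> : m1 - U y - (m2 - U x) = (m1 - m2) - (U y - U x) by ring.
apply: (le_trans (ler_normB _ _)); apply: lerD; last by apply: lU => //; lra.
have yx0 : `|y - x| = y - x by rewrite ger0_norm// subr_ge0 ltW.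
apply: min_dist.
  have -> : U l + q * (y - l) - (U l + q * (x - l)) = q * (y - x) by ring.
  rewrite normrM yx0; apply: ler_wpM2r; first by lra.
  by rewrite lerDr.
have -> : U r - p * (r - y) - (U r - p * (r - x)) = p * (y - x) by ring.
rewrite normrM yx0; apply: ler_wpM2r; first by lra.
by rewrite lerDl.
Qed.

Lemma is_derive_left f x l s D : l < x -> is_derive x 1 f D ->
  (forall y, l <= y <= x -> f y = f x + s * (y - x)) -> D = s.
Proof.
move=> lx [df <-] fs.
have H : cvg (h^-1 *: (f (h *: 1 + x) - f x) @[h --> 0^']) by exact: df.
rewrite /derive; rewrite (@cvg_at_leftE _ _ _ _ H); apply: cvg_lim; first exact: Rhausdorff.
apply: cvg_near_cst; near=> h.
have h0 : h < 0 by near: h; exact: nbhs_left_lt.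
have hl : l - x < h by near: h; apply: nbhs_left_gt; lra.
rewrite scaler1 fs; last by apply/andP; split; lra.
rewrite [LHS]mulrC addrC addKr addrK mulfK//.
Unshelve. all: by end_near. Qed.

Lemma is_derive_right f x r s D : x < r -> is_derive x 1 f D ->
  (forall y, x <= y <= r -> f y = f x + s * (y - x)) -> D = s.
Proof.
move=> xr [df <-] fs.
have H : cvg (h^-1 *: (f (h *: 1 + x) - f x) @[h --> 0^']) by exact: df.
rewrite /derive; rewrite (@cvg_at_rightE _ _ _ _ H); apply: cvg_lim; first exact: Rhausdorff.
apply: cvg_near_cst; near=> h.
have h0 : 0 < h by near: h; exact: nbhs_right_gt.
have hr : h < r - x by near: h; apply: nbhs_right_lt; lra.
rewrite scaler1 fs; last by apply/andP; split; lra.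
rewrite [LHS]mulrC addrC addKr addrK mulfK//.
Unshelve. all: by end_near. Qed.

(** Since [p <= q], the branch of slope [q] is the smaller one on an initial
    segment of the component. At a point of that segment the derivative is the
    left derivative [q]; beyond it, the right derivative [p]. *)
Lemma tent_slope p q Omega U l r x D : open Omega -> component Omega l r ->
  p * (r - l) <= U r - U l <= q * (r - l) -> l < x < r ->
  is_derive x 1 (tent p q Omega U) D -> D = p \/ D = q.
Proof.
move=> oO clr pq /andP[lx xr] dt; have [lr _ _ _] := clr.
have qp : p <= q by rewrite -(@ler_pM2r _ (r - l)) ?subr_gt0//; case/andP: pq => /le_trans; exact.
have tE y : l <= y -> y <= r -> tent p q Omega U y =
    Num.min (U l + q * (y - l)) (U r - p * (r - y)).
  by move=> ly yr; exact: tent_component.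
have [h|h] := leP (U l + q * (x - l)) (U r - p * (r - x)).
- right; apply: (is_derive_left lx dt) => y /andP[ly yx].
  rewrite !tE; [|lra..].
  have : 0 <= (q - p) * (x - y) by apply: mulr_ge0; lra.
  by move=> ?; rewrite !min_l; lra.
- left; apply: (is_derive_right xr dt) => y /andP[xy yr].
  rewrite !tE; [|lra..].
  have : 0 <= (q - p) * (y - x) by apply: mulr_ge0; lra.
  by move=> ?; rewrite !min_r; lra.
Qed.

End tent.

(** * Independence of the values outside the open set *)

Section congruence.
Context {R : realType}.
Notation mu := (@lebesgue_measure R).
Implicit Types (Omega : set R) (u w : R -> R).

Lemma eq_Loo Omega u w : {in Omega, u =1 w} -> Loo Omega u -> Loo Omega w.
Proof.
move=> uw [mu' su]; split; first exact: eq_measurable_fun mu'.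
suff <- : ess_sup_on Omega (fun x => `|u x|%:E) = ess_sup_on Omega (fun x => `|w x|%:E) by [].
by congr ess_sup; apply/funext => x; rewrite /patch; case: ifPn => // xO; rewrite uw.
Qed.

Lemma eq_L1 Omega u w : measurable Omega -> {in Omega, u =1 w} -> L1 Omega u -> L1 Omega w.
Proof. by move=> mO uw; apply: eq_integrable => // x xO; rewrite /= uw. Qed.

Lemma eq_W1oo0 Omega u w : open Omega -> {in Omega, u =1 w} -> W1oo0 Omega u -> W1oo0 Omega w.
Proof.
move=> oO uw [[[[v uv] Lu Lu'] cl] [_ Bu Bu']]; have mO := open_measurable oO.
have wd : weakly_derivable Omega w by exists v; exact: eq_is_weak_derivative uv.
have wE := eq_weak_derivative uw.
split; split.
- by split => //; [exact: eq_L1 Lu|rewrite -wE].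
- move=> e e0; have [phi tphi uphi] := cl e e0; exists phi; first exact: tphi.
  suff -> : W11_norm Omega (w \- phi) = W11_norm Omega (u \- phi) by [].
  have uwp : {in Omega, w \- phi =1 u \- phi} by move=> x xO; rewrite /= uw.
  rewrite /W11_norm (eq_weak_derivative uwp); congr (_ + _)%E.
  by apply: eq_integral => x xO; rewrite uwp.
- by [].
- exact: eq_Loo Bu.
- by rewrite -wE.
Qed.

End congruence.

(** * Existence of a minimizer *)

Section minimization.
Context {R : realType}.
Notation mu := (@lebesgue_measure R).
Implicit Types (Omega : set R) (f u w U : R -> R) (a b l r p q x y z L D s t : R).

(** The derivative of a test function integrates to zero over each component.
    Approximation in mean carries this over to [u - U]; hence the weak
    derivative of [u] has the same integral as that of [U]. *)
Lemma admissible_integral Omega a b L U u l r : open Omega -> a < b ->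
  (forall x, Omega x -> a < x < b) -> lipschitz_itv L a b U ->
  admissible Omega U u -> component Omega l r -> a <= l -> r <= b ->
  mu.-integrable `]l, r[ (EFin \o weak_derivative Omega u) /\
  \int[mu]_(x in `]l, r[) weak_derivative Omega u x = U r - U l.
Proof.
move=> oO ab Oab lU [[[[v0 wv0] _ L1w'] cl] _] [lr Ol Or lrO] al rb.
have mO := open_measurable oO.
set w := u \- U in wv0 cl L1w'.
have aeF := ae_filter_ringOfSetsType mu.
have [ww' _] := weak_derivativeP wv0; set w' := weak_derivative Omega w in ww' L1w'.
have [g [mg gL dg]] := lipschitz_density ab lU.
have mgab : measurable_fun `[a, b] g by exact: measurable_funTS.
have [ig gE] := lipschitz_FTC ab lU mgab dg.
have Ug := lipschitz_weak_derivative ab oO Oab lU mgab dg.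
have uw : is_weak_derivative Omega u (w' \+ g).
  apply: eq_is_weak_derivative (is_weak_derivativeD ww' Ug) => // x _.
  by rewrite /w /= subrK.
have [uu' u'E] := weak_derivativeP uw.
have sub : `]l, r[%classic `<=` Omega by move=> x /=; rewrite in_itv/=; exact: lrO.
have iw' : mu.-integrable `]l, r[ (EFin \o w') by exact: integrableS L1w'.
have ig' : mu.-integrable `]l, r[ (EFin \o g).
  apply: (@integrableS _ _ _ mu `[a, b]) => //.
  by apply: subset_itv; rewrite bnd_simp.
have iwg : mu.-integrable `]l, r[ (EFin \o (w' \+ g)).
  have -> : EFin \o (w' \+ g) = ((EFin \o w') \+ (EFin \o g))%E by apply/funext.
  exact: integrableD.
have mu' : measurable_fun `]l, r[ (weak_derivative Omega u).
  by have [_ [m _ _] _] := uu'; exact: measurable_funS m.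
have u'Elr : {ae mu, forall x, `]l, r[%classic x -> weak_derivative Omega u x = (w' \+ g) x}.
  by apply: (@filterS _ _ aeF _ _ _ u'E) => x E /sub.
have iu' : mu.-integrable `]l, r[ (EFin \o weak_derivative Omega u).
  exact: ae_integrable u'Elr.
split=> //.
have -> : \int[mu]_(x in `]l, r[) weak_derivative Omega u x =
    \int[mu]_(x in `]l, r[) (w' x + g x).
  congr fine; apply: ae_eq_integral => //.
  - exact: measurable_int iu'.
  - exact: measurable_int iwg.
  - by apply: (@filterS _ _ aeF _ _ _ u'Elr) => x E /E ->.
have FTC K W G : lipschitz_itv K a b W -> measurable_fun `[a, b] G ->
   {ae mu, forall x, a < x < b -> is_derive x 1 W (G x)} ->
   mu.-integrable `]l, r[ (EFin \o G) /\ \int[mu]_(x in `]l, r[) G x = W r - W l.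
  move=> lW mG dW; have [iG <-//] := lipschitz_FTC ab lW mG dW; last exact: ltW.
  have iG' : mu.-integrable `[l, r] (EFin \o G).
    apply: (@integrableS _ _ _ mu `[a, b]) => //.
    by apply: subset_itv; rewrite bnd_simp.
  split; first by apply: (@integrableS _ _ _ mu `[l, r]) => //; exact: subset_itv_oo_cc.
  rewrite -Rintegral_itv_obnd_cbnd; last first.
    by apply: (@integrableS _ _ _ mu `[l, r]) => //; exact: subset_itv_oc_cc.
  rewrite -Rintegral_itv_bndo_bndc//.
  by apply: (@integrableS _ _ _ mu `[l, r]) => //; exact: subset_itv_oo_cc.
rewrite RintegralD//; have [_ ->] := FTC _ _ _ lU mgab dg.
suff -> : \int[mu]_(x in `]l, r[) w' x = 0 by rewrite add0r.
apply/eqP; rewrite -normr_eq0 eq_le normr_ge0 andbT; apply/ler_addgt0Pr => e e0.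
rewrite add0r; have [phi tphi] := cl e e0.
have phid := test_function_weak_derivative oO ab Oab tphi.
rewrite (W11_normE oO (is_weak_derivativeB ww' phid)) => lte.
have [K lphi] := test_function_lipschitz ab tphi.
have [iphi phiE] : mu.-integrable `]l, r[ (EFin \o phi^`()%classic) /\
    \int[mu]_(x in `]l, r[) phi^`()%classic x = phi r - phi l.
  apply: (FTC K) => //; first exact: test_function_derive_measurable tphi.
  by apply: aeW => x _; exact: test_function_is_derive tphi.
have -> : \int[mu]_(x in `]l, r[) w' x = \int[mu]_(x in `]l, r[) (w' x - phi^`()%classic x).
  by rewrite RintegralB// phiE !(test_function_out tphi)// subrr subr0.
have iwp : mu.-integrable `]l, r[ (EFin \o (w' \- phi^`()%classic)).
  have -> : EFin \o (w' \- phi^`()%classic) =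
    ((EFin \o w') \- (EFin \o phi^`()%classic))%E by apply/funext.
  exact: integrableB.
apply: (le_trans (le_normr_Rintegral _ iwp)) => //.
have iabs : mu.-integrable `]l, r[ (fun x => `|(w' \- phi^`()%classic) x|%:E).
  exact: integrable_abse iwp.
rewrite -lee_fin /Rintegral fineK; last exact: integrable_fin_num.
have [_ [mw' _ _] _] := ww'.
apply: (@le_trans _ _ (\int[mu]_(x in Omega) `|(w' \- phi^`()%classic) x|%:E)%E).
  apply: ge0_subset_integral => //.
  apply/measurable_EFinP; apply: measurableT_comp => //; apply: measurable_funB => //.
  exact: test_function_derive_measurable tphi.
apply: le_trans (ltW lte); rewrite leeDr//; exact: integral_ge0.
Qed.

Lemma ereal_between (m : \bar R) y : (m < y%:E)%E -> exists t, (m < t%:E)%E /\ t < y.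
Proof.
case: m => [s|//|]; last by move=> _; exists (y - 1); rewrite ltNyr; split=> //; lra.
by rewrite lte_fin => sy; exists ((s + y) / 2); rewrite lte_fin; split; lra.
Qed.

Lemma ae_le_Rintegral (A : set R) f h : measurable A -> mu.-integrable A (EFin \o f) ->
  mu.-integrable A (EFin \o h) -> {ae mu, forall x, A x -> f x <= h x} ->
  \int[mu]_(x in A) f x <= \int[mu]_(x in A) h x.
Proof.
move=> mA fi hi fh; have aeF := ae_filter_ringOfSetsType mu.
(* Replacing [f] by [min f h] changes it on a null set only, and turns the a.e.
   inequality into a pointwise one. *)
pose k x := Num.min (f x) (h x).
have mf : measurable_fun A f by apply/measurable_EFinP; case/integrableP: fi.
have mh : measurable_fun A h by apply/measurable_EFinP; case/integrableP: hi.
have mk : measurable_fun A k by exact: measurable_minr.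
have kf : {ae mu, forall x, A x -> k x = f x}.
  by apply: (@filterS _ _ aeF _ _ _ fh) => x E /E; rewrite /k => ?; rewrite min_l.
have ik := ae_integrable mA fi mk kf.
have -> : \int[mu]_(x in A) f x = \int[mu]_(x in A) k x.
  congr fine; apply: ae_eq_integral => //; [exact/measurable_EFinP|exact/measurable_EFinP|].
  by apply: (@filterS _ _ aeF _ _ _ kf) => x E /E ->.
by apply: le_Rintegral => // x _; rewrite /k ge_min lexx orbT.
Qed.

Lemma component_bounds Omega a b l r : (forall x, Omega x -> a < x < b) ->
  component Omega l r -> a <= l /\ r <= b.
Proof.
move=> Oab [lr Ol Or lrO].
have /andP[am mb] : a < (l + r) / 2 < b by apply: Oab; apply: lrO; apply/andP; split; lra.
split; rewrite leNgt; apply/negP => h.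
  have : Omega a by apply: lrO; apply/andP; split; lra.
  by move=> /Oab; rewrite ltxx.
have : Omega b by apply: lrO; apply/andP; split; lra.
by move=> /Oab; rewrite ltxx andbF.
Qed.

(** The supremum [p] of the points [x] such that [f] exceeds some level above
    [m] on the whole of [`]-oo, x[]. If [f p > m], then by continuity [f] exceeds
    a level above [m] up to some point beyond [p]. *)
Lemma sublevel_edge f (m : \bar R) z : continuous f ->
  (exists t, (m < t%:E)%E) ->
  (forall t, (m < t%:E)%E -> exists x, forall y, y < x -> t < f y) ->
  (forall x t, (m < t%:E)%E -> (forall y, y < x -> t < f y) -> x <= z) ->
  exists2 p, ((f p)%:E <= m)%E &
    forall z', (forall x t, (m < t%:E)%E -> (forall y, y < x -> t < f y) -> x <= z') -> p <= z'.
Proof.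
move=> cf [t0 mt0] ex ub.
pose S := [set x | exists t, (m < t%:E)%E /\ forall y, y < x -> t < f y].
have S0 : has_sup S.
  split; first by have [x xP] := ex _ mt0; exists x, t0.
  by exists z => x [t [mt]]; exact: ub.
exists (sup S); last first.
  by move=> z' z'P; apply: ge_sup => [|x [t [mt]]]; [case: S0|exact: z'P].
rewrite leNgt; apply/negP => mf.
have [t [mt tf]] : exists t, (m < t%:E)%E /\ t < f (sup S).
  exact: ereal_between.
have : \forall y \near sup S, t < f y.
  have cc : f y @[y --> sup S] --> f (sup S) by exact: cf.
  by move/cvgr_gt: cc; apply.
move=> /nbhs_ballP[e /= e0 eP].
have [x [s [ms sP]] xs] := sup_adherent e0 S0.
have : sup S + e / 2 <= sup S.
  apply: sup_ubound; first by case: S0.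
  exists (Num.min s t); split; first by rewrite /Num.min; case: ifP.
  move=> y yS; rewrite gt_min; have [yx|xy] := ltP y x; first by rewrite sP.
  rewrite (eP y) ?orbT// /ball/= ltr_norml; apply/andP; split; lra.
lra.
Qed.

(** The edges [p] and [q] of the sublevel set of [f] at the infimum [m] enclose
    the slope of every chord of [U] over a component, because the derivative of
    a competitor of energy close to [m] averages to that slope. The tent with
    slopes [p] and [q] is then a competitor of energy at most [m]. *)
Lemma exists_minimizer Omega f U a b L : continuous f ->
  (forall t, exists T : R, forall y, T < `|y| -> t < f y) ->
  open Omega -> a < b -> (forall x, Omega x -> a + 1 < x < b - 1) ->
  0 < L -> lipschitz_itv L a b U ->
  exists u, is_solution Omega f U u.
Proof.
move=> cf coer oO ab Oab1 L0 lU.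
have Oab x : Omega x -> a < x < b by move=> /Oab1 /andP[? ?]; apply/andP; split; lra.
have Oa : ~ Omega a by move=> /Oab; rewrite ltxx.
have Ob : ~ Omega b by move=> /Oab; rewrite ltxx andbF.
have aeF := ae_filter_ringOfSetsType mu.
set m := ereal_inf (sup_energy Omega f @` admissible Omega U).
have solve u : admissible Omega U u -> (sup_energy Omega f u <= m)%E -> is_solution Omega f U u.
  move=> au um; split => //; apply/eqP; rewrite eq_le um /=.
  by apply: ereal_inf_lbound; exists u.
have admU : admissible Omega U U.
  apply: (@lipschitz_W1oo0 _ Omega a b 1 _ (cst 0)) => //.
  - by move=> x y ax xy yb /=; rewrite !subrr normr0 mul1r subr_ge0.
  - by move=> x _ /=; rewrite subrr.
  - by move=> x; rewrite normr0.
  - apply: aeW => x _; have -> : U \- U = cst 0 by apply/funext => y /=; rewrite subrr.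
    exact: is_derive_cst.
have [[x0 Ox0]|O0] := pselect (Omega !=set0); last first.
  exists U; apply: solve => //; apply/ess_sup_onP; apply: aeW => x Ox.
  by exfalso; apply: O0; exists x.
have [moo|mfin] := eqVneq m +oo%E.
  by exists U; apply: solve => //; rewrite moo leey.
have mlt : (m < +oo)%E by rewrite ltey.
have [t0 mt0] : exists t, (m < t%:E)%E.
  move: mlt; case: (m) => [s|//|] _; first by exists (s + 1); rewrite lte_fin; lra.
  by exists 0; rewrite ltNyr.
(* On a component, a competitor of energy at most [t] is only remembered
   through its derivative. *)
have competitor t l r : (m < t%:E)%E -> component Omega l r -> exists u',
    [/\ mu.-integrable `]l, r[ (EFin \o u'),
        \int[mu]_(x in `]l, r[) u' x = U r - U l &
        {ae mu, forall x, `]l, r[%classic x -> f (u' x) <= t}].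
  move=> /ereal_inf_lt[_ [u au <-]] /ltW /ess_sup_onP ut clr.
  have [al rb] := component_bounds Oab clr.
  have [iu uE] := admissible_integral oO ab Oab lU au clr al rb.
  exists (weak_derivative Omega u); split => //.
  apply: (@filterS _ _ aeF _ _ _ ut) => x ux; rewrite /= in_itv/= => lxr.
  by rewrite -lee_fin; apply: ux; case: clr => _ _ _; exact.
have icst l r c : mu.-integrable `]l, r[ (EFin \o cst c).
  apply: (@integrableS _ _ _ mu `[l, r]) => //; first exact: subset_itv_oo_cc.
  by apply: (@bounded_integrable _ _ _ `|c|) => //; exact: itv_measure_lty.
have cstE l r c : l < r -> \int[mu]_(x in `]l, r[) (cst c) x = c * (r - l).
  by move=> lr; rewrite Rintegral_cst//= lebesgue_measure_itv/= lte_fin lr.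
have below x t l r : (m < t%:E)%E -> (forall y, y < x -> t < f y) -> component Omega l r ->
    x * (r - l) <= U r - U l.
  move=> mt fx clr; have [u' [iu <- u't]] := competitor t l r mt clr.
  have lr : l < r by case: clr.
  rewrite -cstE//; apply: ae_le_Rintegral => //.
  apply: (@filterS _ _ aeF _ _ _ u't) => y h /h; rewrite /= !leNgt; apply: contra.
  exact: fx.
have above x t l r : (m < t%:E)%E -> (forall y, x < y -> t < f y) -> component Omega l r ->
    U r - U l <= x * (r - l).
  move=> mt fx clr; have [u' [iu <- u't]] := competitor t l r mt clr.
  have lr : l < r by case: clr.
  rewrite -cstE//; apply: ae_le_Rintegral => //.
  apply: (@filterS _ _ aeF _ _ _ u't) => y h /h; rewrite /= !leNgt; apply: contra.
  exact: fx.
have [l0 [r0 [clr0 _ _ _]]] : exists l r, [/\ component Omega l r, l < x0 < r, a <= l & r <= b].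
  by have /andP[? ?] := Oab _ Ox0; apply: component_in => //; exact: ltW.
have lr0 : l0 < r0 by case: clr0.
have exm : exists t, (m < t%:E)%E by exists t0.
have [p fp pP] : exists2 p, ((f p)%:E <= m)%E &
    forall l r, component Omega l r -> p * (r - l) <= U r - U l.
  have [||p fp pP] := @sublevel_edge f m ((U r0 - U l0) / (r0 - l0)) cf exm.
  - move=> t mt; have [T TP] := coer t; exists (- `|T|) => y yT; apply: TP.
    apply: (le_lt_trans (ler_norm T)); rewrite -(normrN y).
    by apply: lt_le_trans (ler_norm _); rewrite ltrNr.
  - by move=> x t mt fx; rewrite ler_pdivlMr ?subr_gt0//; exact: below fx clr0.
  exists p => // l r clr; have lr : l < r by case: clr.
  rewrite -ler_pdivlMr ?subr_gt0//; apply: pP => x t mt fx.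
  by rewrite ler_pdivlMr ?subr_gt0//; exact: below fx clr.
have [q fq qP] : exists2 q, ((f q)%:E <= m)%E &
    forall l r, component Omega l r -> U r - U l <= q * (r - l).
  (* The upper edge is the lower edge of the reflected integrand. *)
  have cfN : continuous (fun y => f (- y)).
    by move=> y; apply: (@continuous_comp _ _ _ -%R f); [exact: oppr_continuous|exact: cf].
  have fN x t : (forall y, y < x -> t < f (- y)) -> forall y, - x < y -> t < f y.
    by move=> h y xy; rewrite -[y]opprK; apply: h; rewrite ltrNl.
  have [||q fq qP] := @sublevel_edge (fun y => f (- y)) m (- ((U r0 - U l0) / (r0 - l0)))
      cfN exm.
  - move=> t mt; have [T TP] := coer t; exists (- `|T|) => y yT; apply: TP.
    apply: (le_lt_trans (ler_norm T)).
    by apply: lt_le_trans (ler_norm _); rewrite ltrNr.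
  - move=> x t mt /fN fx; rewrite lerNr ler_pdivrMr ?subr_gt0//; exact: above fx clr0.
  exists (- q) => // l r clr; have lr : l < r by case: clr.
  rewrite -ler_pdivrMr ?subr_gt0// lerNr; apply: qP => x t mt /fN fx.
  by rewrite lerNr ler_pdivrMr ?subr_gt0//; exact: above fx clr.
have pq l r : component Omega l r -> p * (r - l) <= U r - U l <= q * (r - l).
  by move=> clr; rewrite pP ?qP.
pose u := tent p q Omega U.
have C0 : 0 < `|p| + `|q| + L by rewrite ltr_wpDl.
have lw := tent_lipschitz oO Oa Ob (ltW L0) lU Oab pq.
have [g [mg gC dg]] := lipschitz_density ab lw.
have [gU [mgU gUL dgU]] := lipschitz_density ab lU.
have w0 x : ~ Omega x -> (u \- U) x = 0 by move=> Ox; rewrite /= /u tent_out// subrr.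
exists u; apply: solve; first exact: (lipschitz_W1oo0 oO ab C0 Oab1 lw w0 mg gC dg).
have mgab (G : R -> R) : measurable_fun setT G -> measurable_fun `[a, b] G.
  by move=> mG; exact: measurable_funTS.
have wd := is_weak_derivativeD (lipschitz_weak_derivative ab oO Oab lw (mgab _ mg) dg)
             (lipschitz_weak_derivative ab oO Oab lU (mgab _ mgU) dgU).
have uE : (u \- U) \+ U = u by apply/funext => x /=; rewrite subrK.
rewrite -/u uE in wd; have [_ u'E] := weak_derivativeP wd.
apply/ess_sup_onP.
apply: (@filterS3 _ _ aeF _ _ _ _ _ dg dgU u'E) => x gx gUx u'x Ox.
have xab := Oab _ Ox; have [ax xb] := andP xab.
rewrite u'x//; have du : is_derive x 1 u ((g \+ gU) x).
  have := @is_deriveD _ _ _ _ _ _ _ _ _ (gx xab) (gUx xab).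
  by rewrite -[X in is_derive _ _ X]/((u \- U) \+ U) uE.
have [l [r [clr lxr _ _]]] := component_in oO Oa Ob (ltW ax) (ltW xb) Ox.
by have [->|->] := tent_slope oO clr (pq _ _ clr) lxr du.
Qed.

End minimization.

Theorem corollary4p4 (R : realType) (Omega : set R) (f gamma : R -> R)
  (Omega_open : open Omega) (Omega_bounded : bounded_set Omega)
  (f_cont : continuous f)
  (gamma_ge0 : forall t, 0 <= t -> 0 <= gamma t)
  (gamma_cont : {within `[0, +oo[, continuous gamma})
  (gamma_incr : {in `[0, +oo[ &, {homo gamma : s t / s <= t}})
  (gamma_lim : gamma t @[t --> +oo] --> +oo)
  (f_ge : forall xi, gamma `|xi| <= f xi)
  (u0 : R -> R) (u0_lip : [lipschitz u0 x | x in boundary Omega])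
  (U0 : R -> R) (U0_ext : lipschitz_extension Omega u0 U0) :
  exists u : R -> R, is_solution Omega f U0 u.
Proof.
have [U [L [L0 UE lU]]] : exists U L, [/\ 0 < L, {in Omega, U0 =1 U} &
    forall x y, `|U x - U y| <= L * `|x - y|].
  have [[x0 Ox0]|O0] := pselect (Omega !=set0); last first.
    exists (cst 0), 1; split=> [//|x|x y]; last by rewrite subrr normr0 mul1r.
    by rewrite inE => Ox; exfalso; apply: O0; exists x.
  have [L L0 lU0] := lipschitz_onP U0_ext.1.
  have cO0 : closure Omega !=set0 by exists x0; exact: subset_closure.
  have [U [UE lU]] := lipschitz_extend cO0 (ltW L0) lU0.
  exists U, L; split=> // x; rewrite inE => Ox.
  by rewrite UE//; exact: subset_closure.
have [M M0 OM] : exists2 M : R, 0 <= M & forall x, Omega x -> `|x| <= M.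
  have [M [_ OM]] := Omega_bounded; exists (`|M| + 1); first by rewrite addr_ge0.
  by move=> x; apply: OM; rewrite (le_lt_trans (ler_norm M))// ltrDl.
have coer t : exists T, forall y, T < `|y| -> t < f y.
  have [T [_ TP]] : \forall s \near +oo, t < gamma s by move/cvgryPgt: gamma_lim; exact.
  by exists T => y /TP /lt_le_trans; apply; exact: f_ge.
have [u [au uE]] : exists u, is_solution Omega f U u.
  apply: (@exists_minimizer _ Omega f U (- M - 2) (M + 2) L) => //; first by lra.
    by move=> x /OM; rewrite ler_norml => /andP[? ?]; apply/andP; split; lra.
  by move=> x y _ xy _; rewrite -[y - x]ger0_norm ?subr_ge0.
have admE : admissible Omega U0 = admissible Omega U.
  apply/seteqP; split=> v; apply: eq_W1oo0 => // x xO; by rewrite /= UE.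
exists u; split; rewrite admE; [exact: au|exact: uE].
Qed.
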